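(* The problem WPPSG$_1$ can be solved efficiently (in polynomial time).
   Context: $\mathcal{S}_n$ is the symmetric group on $[n]=\{1,\ldots,n\}$, products composed left to right; for $X\subseteq[n]$, $\mathcal{S}_X$ is the subgroup of permutations fixing every element of $[n]\setminus X$. WPPSG: given integers $n,m\ge1$, sets $X_1,\ldots,X_m\subseteq[n]$ and $\tau_0\in\mathcal{S}_n$, decide whether there exist $\sigma_j\in\mathcal{S}_{X_j}$ ($j=1,\ldots,m$) with $\tau_0=\sigma_1\cdots\sigma_m$. WPPSG$_1$ is the restriction of WPPSG to instances whose sets $X_1,\ldots,X_m$ have the consecutive ones property: there is a permutation $\pi$ of $[n]$ such that, writing $\pi$ as the sequence $(1\pi,\ldots,n\pi)$, the elements of each $X_j$ occur in consecutive positions. *)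

(* Defs.v *)
From HB Require Import structures.
From mathcomp Require Import all_boot all_fingroup.

Set Implicit Arguments.
Unset Strict Implicit.
Unset Printing Implicit Defensive.

Inductive move := MoveL | MoveN | MoveR.

(* A two-way infinite tape over a type with a blank: the cells left of the
   head (nearest first), the scanned cell, the cells right of the head
   (nearest first); all cells beyond the two lists are blank. *)
Record tape (A : Type) := Tape {
  tape_left : seq (option A);
  tape_head : option A;
  tape_right : seq (option A)
}.

Definition blank_tape (A : Type) : tape A := Tape [::] None [::].

Definition input_tape (A : Type) (w : seq A) : tape A :=
  Tape [::] (ohead w) (map some (behead w)).

Definition tape_write (A : Type) (a : option A) (t : tape A) : tape A :=
  Tape (tape_left t) a (tape_right t).

Definition tape_move (A : Type) (d : move) (t : tape A) : tape A :=
  let: Tape l a r := t in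
  match d with
  | MoveL => Tape (behead l) (head None l) (a :: r)
  | MoveN => t
  | MoveR => Tape (a :: l) (head None r) (behead r)
  end.

(* The tape alphabet consists of the input alphabet [S], the auxiliary symbols
   [tm_aux] and the blank [None]. There are [tm_tapes.+1] tapes; tape [ord0]
   holds the input. [tm_halt q = Some b] means that [q] is a halting state, with
   verdict "accept" ([b = true]) or "reject" ([b = false]). *)
Record turing_machine (S : finType) := TuringMachine {
  tm_tapes : nat;
  tm_aux : finType;
  tm_state : finType;
  tm_start : tm_state;
  tm_halt : tm_state -> option bool;
  tm_trans :
    tm_state -> {ffun 'I_tm_tapes.+1 -> option (S + tm_aux)} ->
    tm_state * ('I_tm_tapes.+1 -> option (S + tm_aux) * move)
}.

Section Run.
Variables (S : finType) (M : turing_machine S).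

Definition tm_config : Type :=
  tm_state M * {ffun 'I_(tm_tapes M).+1 -> tape (S + tm_aux M)}.

Definition tm_init (w : seq S) : tm_config :=
  (tm_start M,
   [ffun i => if i == ord0 then input_tape (map inl w)
              else blank_tape (S + tm_aux M)]).

Definition tm_step (c : tm_config) : tm_config :=
  if tm_halt c.1 is Some _ then c else
  let: (q, act) := tm_trans c.1 [ffun i => tape_head (c.2 i)] in
  (q, [ffun i => tape_move (act i).2 (tape_write (act i).1 (c.2 i))]).

(* Halting configurations are fixed by [tm_step], so this is the verdict of [M]
   on [w] if [M] halts after at most [t] steps, and [None] otherwise. *)
Definition tm_verdict (w : seq S) (t : nat) : option bool :=
  tm_halt (iter t tm_step (tm_init w)).1.

End Run.

Record decision_problem := DecisionProblem {
  instance : Type;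
  alphabet : finType;
  encode : instance -> seq alphabet;
  yes_instance : instance -> Prop
}.

Definition restrict (P : decision_problem) (D : instance P -> Prop) :
    decision_problem :=
  {| instance := {x : instance P | D x};
     alphabet := alphabet P;
     encode := fun x => encode (sval x);
     yes_instance := fun x => yes_instance (sval x) |}.

(* Any polynomial is bounded by one of the form [c * s ^ d + c]. *)
Definition polytime_solvable (P : decision_problem) : Prop :=
  exists (M : turing_machine (alphabet P)) (c d : nat),
    forall x : instance P,
      exists2 b : bool,
        tm_verdict M (encode x) (c * size (encode x) ^ d + c) = Some b
        & b <-> yes_instance x.

(* The element [i.+1] of [n] = {1, ..., n} is represented by [i : 'I_n]. *)
Record wppsg_instance := WppsgInstance {
  wp_n : nat;
  wp_m : nat;
  wp_n_gt0 : 0 < wp_n;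
  wp_m_gt0 : 0 < wp_m;
  wp_set : 'I_wp_m -> {set 'I_wp_n};
  wp_target : 'S_wp_n
}.

(* In [{perm T}] products are composed from left to right: [permM]. *)
Definition wppsg_yes (x : wppsg_instance) : Prop :=
  exists sigma : 'I_(wp_m x) -> 'S_(wp_n x),
    (forall j, sigma j \in Sym (wp_set j)) /\
    wp_target x = (\prod_(j < wp_m x) sigma j)%g.

Definition symbol : finType := (bool + bool)%type.
Definition digit (b : bool) : symbol := inl b.
Definition comma : symbol := inr false.
Definition semicolon : symbol := inr true.

(* Binary digits of [k], least significant digit first, without leading zeros
   (and [binary 0 = [:: false]]). *)
Definition binary (k : nat) : seq bool :=
  mkseq (fun i => odd (k %/ 2 ^ i)) (trunc_log 2 k).+1.

Definition encode_nat (k : nat) : seq symbol := rcons (map digit (binary k)) comma.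

Definition encode_list (s : seq nat) : seq symbol :=
  rcons (flatten (map encode_nat s)) semicolon.

(* An instance is written "n,m;1 tau,...,n tau;X_1;...;X_m;", each set being
   written as the increasing list of its elements. *)
Definition wppsg_encode (x : wppsg_instance) : seq symbol :=
  encode_list [:: wp_n x; wp_m x]
  ++ encode_list [seq (wp_target x i).+1 | i <- enum 'I_(wp_n x)]
  ++ flatten [seq encode_list [seq i.+1 | i : 'I_(wp_n x) <- enum (wp_set j)]
             | j <- enum 'I_(wp_m x)].

Definition WPPSG : decision_problem :=
  {| instance := wppsg_instance;
     alphabet := symbol;
     encode := wppsg_encode;
     yes_instance := wppsg_yes |}.

(* [pi p] is the element in position [p] of the sequence (1 pi, ..., n pi). *)
Definition consecutive_ones (x : wppsg_instance) : Prop :=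
  exists pi : 'S_(wp_n x), forall (j : 'I_(wp_m x)) (p q r : 'I_(wp_n x)),
    p <= q <= r -> pi p \in wp_set j -> pi r \in wp_set j -> pi q \in wp_set j.

Definition WPPSG1 : decision_problem := restrict (P := WPPSG) consecutive_ones.

(* Main.v *)
(* Call [x < y] forced by [z < y] when some set contains [x] and [z] but not
   [y]. Adding an arbitrary incomparable pair to a partial order closed under
   forcing and then closing under forcing and transitivity creates no cycle when
   a consecutive ordering exists: the forcing class of the pair is antisymmetric,
   and the triangle lemma shows that it is transitive and absorbs the pairs of
   the old order between two of its own. Repeating this yields a linear order in
   which all sets are intervals.

   For intervals, the products of the groups S_{X_j}, ..., S_{X_m} form a set
   closed under swapping two values that are out of order. Hence one may replace
   the target by the permutation sorted inside X_1, drop X_1, and continue; the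
   answer is yes iff the identity is reached.

   For the running time, the algorithm is written with bounded loops, bit arrays
   and variables that saturate at the input length. Such programs compile to
   stack programs and then to multi-tape Turing machines, with a cost that is
   polynomial by structural induction. *)
Require Import Defs.
From mathcomp Require Import all_boot all_fingroup.
From mathcomp Require Import zify.
From Stdlib Require Import Classical Relation_Operators Operators_Properties.

Set Implicit Arguments.
Unset Strict Implicit.
Unset Printing Implicit Defensive.

(** * Stack programs and Turing machines *)

(** The ordering [pi] is not part of the input. Its existence is used only to make forcing classes
    antisymmetric; this is why an incomparable pair may be oriented arbitrarily and no choice is
    ever revised.

    Closing and sorting are blind repetitions of a pass over all tuples of indices, so no search
    structure has to be programmed. A potential bounds the number of passes that change anything:
    for closing the number of missing pairs, at most N^2; for sorting n^3 minus the sum of rank x *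
    rank (t x), which drops at each swap by the rearrangement inequality. Hence the repetition
    counts N^2 + 1 and N^3 + 1.

    X_1 may be dropped once the target t is sorted inside it: if t = u r with u in S_{X_1}, the rest
    r can be sorted inside X_1 without leaving the remaining product, and then u is monotone on X_1,
    so u = 1.

    A stack is the part of a tape from the head to the right, so a push, pop or transfer takes at
    most two machine steps. Saturation at N does no harm because n + m + 4 < N, so that elements,
    positions and list numbers are all below N. *)

Definition sname : eqType := (nat * nat)%type.

Section StackPrograms.
Variable S : finType.

Definition cell : eqType := (S + bool)%type.
Definition cell0 : cell := inr false.
Definition cell1 : cell := inr true.

Definition stacks := sname -> seq cell.

Definition upd (st : stacks) (s : sname) (v : seq cell) : stacks :=
  fun s' => if s' == s then v else st s'.

(** [Xfer] moves a top cell to another stack and supplies [cell0] when the source is empty: a stack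
    is read as if followed by endless zeros, which is how unbounded arrays are stored later. *)
Inductive prog :=
| Skip
| Push of sname & cell
| Pop of sname
| Xfer of sname & sname
| Seq of prog & prog
| IfTop of sname & (option cell -> bool) & prog & prog
| WhileNE of sname & prog.

(** The number is the exact count of machine steps of the compiled code: a push or transfer moves
    and then writes, and a true test also pays for the jump over the other branch or back to the
    loop head. *)
Inductive run : prog -> stacks -> nat -> stacks -> Prop :=
| RunSkip st : run Skip st 0 st
| RunPush s g st : run (Push s g) st 2 (upd st s (g :: st s))
| RunPop s st : run (Pop s) st 1 (upd st s (behead (st s)))
| RunXfer s s' st : s != s' ->
    run (Xfer s s') st 2
      (upd (upd st s (behead (st s))) s' (head cell0 (st s) :: st s'))
| RunSeq p q st n st' n' st'' :
    run p st n st' -> run q st' n' st'' -> run (Seq p q) st (n + n') st''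
| RunIfT s (f : option cell -> bool) p q st n st' : f (ohead (st s)) -> run p st n st' ->
    run (IfTop s f p q) st n.+2 st'
| RunIfF s (f : option cell -> bool) p q st n st' : ~~ f (ohead (st s)) -> run q st n st' ->
    run (IfTop s f p q) st n.+1 st'
| RunWhileT s p st n st' n' st'' : st s != [::] -> run p st n st' ->
    run (WhileNE s p) st' n' st'' -> run (WhileNE s p) st (n + n').+2 st''
| RunWhileF s p st : st s = [::] -> run (WhileNE s p) st 1 st.

Inductive instr :=
| IMoveL of sname
| IWrite of sname & cell
| IPop of sname
| IXfer of sname & sname
| IBranch of sname & (option cell -> bool) & nat.

Definition jump (l : nat) := IBranch (0, 0) xpred0 l.

Fixpoint csize (p : prog) : nat :=
  match p with
  | Skip => 0
  | Push _ _ => 2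
  | Pop _ => 1
  | Xfer _ _ => 2
  | Seq p q => csize p + csize q
  | IfTop _ _ p q => (csize p + csize q).+2
  | WhileNE _ p => (csize p).+2
  end.

(* [b] is the address of the first instruction; a branch falls through when its
   test succeeds. *)
Fixpoint compile (p : prog) (b : nat) : seq instr :=
  match p with
  | Skip => [::]
  | Push s g => [:: IMoveL s; IWrite s g]
  | Pop s => [:: IPop s]
  | Xfer s s' => [:: IMoveL s'; IXfer s s']
  | Seq p q => compile p b ++ compile q (b + csize p)
  | IfTop s f p q =>
      IBranch s f (b + csize p).+2 :: compile p b.+1
      ++ jump ((b + csize p).+2 + csize q) :: compile q (b + csize p).+2
  | WhileNE s p =>
      IBranch s isSome (b + csize p).+2 :: compile p b.+1 ++ [:: jump b]
  end.

Lemma size_compile p b : size (compile p b) = csize p.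
Proof.
elim: p b => //= [p IHp q IHq|s f p IHp q IHq|s p IHp] b.
- by rewrite size_cat IHp IHq.
- by rewrite size_cat /= IHp IHq addnS.
- by rewrite size_cat /= IHp addn1.
Qed.

Definition instr_names (i : instr) : seq sname :=
  match i with
  | IMoveL s | IWrite s _ | IPop s | IBranch s _ _ => [:: s]
  | IXfer s s' => [:: s; s']
  end.

Definition instr_act (i : instr) (h : sname -> option cell) (s : sname) :
    option cell * move :=
  match i with
  | IMoveL s1 => (h s, if s == s1 then MoveL else MoveN)
  | IWrite s1 g => (if s == s1 then Some g else h s, MoveN)
  | IPop s1 => if s == s1 then (None, MoveR) else (h s, MoveN)
  | IXfer s1 s2 =>
      if s == s2 then (Some (odflt cell0 (h s1)), MoveN)
      else if s == s1 then (None, MoveR) else (h s, MoveN)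
  | IBranch _ _ _ => (h s, MoveN)
  end.

Definition instr_next (i : instr) (h : sname -> option cell) (pc : nat) : nat :=
  if i is IBranch s f l then (if f (h s) then pc.+1 else l) else pc.+1.

(** Only the head and the cells to its right are constrained. The left part may be arbitrary because
    a push overwrites the cell it moves to; comparing by [nth] absorbs trailing blanks. *)
Definition rep (t : tape cell) (s : seq cell) : Prop :=
  forall i, nth None (tape_head t :: tape_right t) i = nth None (map some s) i.

Lemma rep_head t s : rep t s -> tape_head t = ohead s.
Proof. by move/(_ 0) => /= ->; case: s. Qed.

Lemma rep_pop t s : rep t s ->
  rep (tape_move MoveR (tape_write None t)) (behead s).
Proof.
case: t => l a r H i; move: (H i.+1) => /=.
have -> : nth None (head None r :: behead r) i = nth None r i.
  by case: r {H} => [|x r] //=; case: i => //= i; rewrite nth_nil.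
by move=> ->; case: s {H} => //=; rewrite nth_nil.
Qed.

(** * Simulation of a compiled stack program by a Turing machine *)

Section Machine.
Variables (p : prog) (out : sname) (verdict : option cell -> bool).

Let code := compile p 0.
(** With [(0, 0)] in front, the input stack gets the tape [ord0]. A name may repeat: [tape_ix] takes
    its first occurrence and the machine leaves the other tapes still. *)
Let names := (0, 0) :: out :: flatten (map instr_names code).
Let K := size names.

Definition tape_ix (s : sname) : 'I_K.+1 := inord (index s names).
Definition tape_name (i : 'I_K.+1) : sname := nth (0, 0) names i.

Definition prog_state : finType := ('I_(size code).+1 + bool)%type.

(** States are code addresses and the two verdicts. Running off the end of the code takes one
    further step, which reads the top of [out]; hence the strict bound [n < t] in
    [prog_machine_verdict]. *)
Definition prog_machine : turing_machine S :=
  @TuringMachine S K (bool : finType) prog_state (inl ord0)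
    (fun q => if q is inr b then Some b else None)
    (fun q reads =>
       let h s := reads (tape_ix s) in
       match q with
       | inr b => (q, fun i => (reads i, MoveN))
       | inl pc =>
           if pc < size code then
             let ins := nth (jump 0) code pc in
             (inl (inord (instr_next ins h pc)),
              fun i => if i == tape_ix (tape_name i)
                       then instr_act ins h (tape_name i) else (reads i, MoveN))
           else (inr (verdict (h out)), fun i => (reads i, MoveN))
       end).

(** The relation [R] is a parameter because a push passes through a configuration in which one tape
    represents no stack: its head has moved left and has not yet written. *)
Definition matches (pc : nat) (R : sname -> tape cell -> Prop)
    (c : tm_config prog_machine) :=
  [/\ pc <= size code, c.1 = inl (inord pc) &
      forall s, s \in names -> R s (c.2 (tape_ix s))].

Lemma tape_ixK s : s \in names -> tape_name (tape_ix s) = s.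
Proof.
move=> sN; rewrite /tape_name /tape_ix inordK ?nth_index //.
by rewrite ltnS ltnW // index_mem.
Qed.

Lemma step_matches pc R c R' pc' :
  pc < size code -> matches pc R c ->
  let ins := nth (jump 0) code pc in
  let h s := tape_head (c.2 (tape_ix s)) in
  pc' = instr_next ins h pc -> pc' <= size code ->
  (forall s, s \in names ->
     R' s (tape_move (instr_act ins h s).2
            (tape_write (instr_act ins h s).1 (c.2 (tape_ix s))))) ->
  matches pc' R' (tm_step c).
Proof.
move=> ltpc [lepc c1 c2] ins h pc'E pc'le H.
have hE s : [ffun i => tape_head (c.2 i)] (tape_ix s) = h s by rewrite ffunE.
have actE s : instr_act ins (fun s => [ffun i => tape_head (c.2 i)] (tape_ix s)) s
            = instr_act ins h s.
  by rewrite /instr_act; case: (ins) => *; rewrite ?hE.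
have nextE : instr_next ins (fun s => [ffun i => tape_head (c.2 i)] (tape_ix s)) pc
            = pc'.
  by rewrite pc'E /instr_next; case: (ins) => *; rewrite ?hE.
rewrite /tm_step c1 /= inordK ?ltnS // ltpc nextE; split=> //= s sN.
by rewrite ffunE tape_ixK // eqxx actE; apply: H.
Qed.

Definition srep (st : stacks) (s : sname) (t : tape cell) := rep t (st s).

Lemma names_code pc s :
  pc < size code -> s \in instr_names (nth (jump 0) code pc) -> s \in names.
Proof.
move=> ltpc sin; rewrite !in_cons; apply/orP; right; apply/orP; right.
elim: (code) pc ltpc sin => //= i l IH [|pc] /= ltpc sin; rewrite mem_cat.
  by rewrite sin.
by rewrite (IH pc) ?orbT.
Qed.

(** Induction on the run. The code of [q] is only required to sit at address [b] inside the whole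
    code, so that the induction hypotheses apply to subprograms in place. *)
Lemma run_matches q st n st' : run q st n st' ->
  forall b c, (forall i, i < csize q -> 
     b + i < size code /\ nth (jump 0) code (b + i) = nth (jump 0) (compile q b) i) ->
  b + csize q <= size code ->
  matches b (srep st) c ->
  matches (b + csize q) (srep st') (iter n (@tm_step _ prog_machine) c).
Proof.
elim=> {q st n st'} /=.
- by move=> st b c _ _; rewrite addn0.
- move=> s g st b c H le M0.
  have [l0 e0] := H 0 isT; have [l1 e1] := H 1 isT.
  rewrite addn0 in l0 e0; rewrite addn1 in l1 e1.
  (* Between [IMoveL] and [IWrite] the cell under the head is unknown; the old stack lies strictly
     to its right. *)
  pose R s' t := if s' == s then
     forall i, nth None (tape_right t) i = nth None (map some (st s)) i else srep st s' t.
  have M1 : matches b.+1 R (tm_step c).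
    apply: (step_matches l0 M0) => //; first by rewrite e0.
    case: M0 => _ _ c2 s' s'N; rewrite e0 /= /R; case: eqP => [E|_]; last first.
      by move: (c2 _ s'N); rewrite /srep; case: (c.2 _).
    by move: (c2 _ s'N); rewrite E /srep; case: (c.2 _).
  rewrite addn2; apply: (step_matches l1 M1) => //; first by rewrite e1.
  case: M1 => _ _ c2 s' s'N; rewrite e1 /= /srep /upd; move: (c2 _ s'N); rewrite /R.
  case: eqP => [_|_]; case: (_ (tape_ix s')) => l a r //= H' [|i] //=.
- move=> s st b c H le M0.
  have [l0 e0] := H 0 isT; rewrite addn0 in l0 e0.
  rewrite addn1; apply: (step_matches l0 M0) => //; first by rewrite e0.
  case: M0 => _ _ c2 s' s'N; rewrite e0 /= /srep /upd; case: eqP => [E|_].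
    by rewrite E; apply: rep_pop; rewrite -E; move: (c2 _ s'N); rewrite E.
  by move: (c2 _ s'N); rewrite /srep; case: (c.2 _).
- move=> s s1 st neq b c H le M0.
  have [l0 e0] := H 0 isT; have [l1 e1] := H 1 isT.
  rewrite addn0 in l0 e0; rewrite addn1 in l1 e1.
  pose R s' t := if s' == s1 then
     forall i, nth None (tape_right t) i = nth None (map some (st s1)) i else srep st s' t.
  have M1 : matches b.+1 R (tm_step c).
    apply: (step_matches l0 M0) => //; first by rewrite e0.
    case: M0 => _ _ c2 s' s'N; rewrite e0 /= /R; case: eqP => [E|_]; last first.
      by move: (c2 _ s'N); rewrite /srep; case: (c.2 _).
    by move: (c2 _ s'N); rewrite E /srep; case: (c.2 _).
  rewrite addn2; apply: (step_matches l1 M1) => //; first by rewrite e1.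
  have sN : s \in names by apply: (names_code l1); rewrite e1 /= inE eqxx.
  case: M1 => _ _ c2 s' s'N; rewrite e1 /= /srep /upd; move: (c2 _ s'N) (c2 _ sN).
  rewrite /R (negbTE neq) => + /rep_head ->.
  case: eqP => [_|_]; first by case: (_ (tape_ix s')) => l a r //= H' [|i] //=; case: (st s).
  case: eqP => [->|_]; first by move/rep_pop.
  by case: (_ (tape_ix s')).
- move=> p1 p2 st n1 st1 n2 st2 _ IH1 _ IH2 b c H le M0.
  rewrite (addnC n1) iterD addnA; apply: IH2; last 1 first.
  + apply: IH1 => //; last lia.
    move=> i li; have [|l e] := H i _; first lia.
    by split=> //; rewrite e nth_cat size_compile li.
  + move=> i li; have [|l e] := H (csize p1 + i) _; first lia.
    rewrite addnA in l e; split=> //; rewrite e nth_cat size_compile.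
    by rewrite ltnNge leq_addr /= addKn.
  + lia.
- move=> s f p1 p2 st n st' ft _ IH b c H le M0.
  have [l0 e0] := H 0 isT; rewrite addn0 /= in l0 e0.
  have sN : s \in names by apply: (names_code l0); rewrite e0 /= inE eqxx.
  have M1 : matches b.+1 (srep st) (tm_step c).
    apply: (step_matches l0 M0) => //.
      by case: M0 => _ _ /(_ _ sN) /rep_head hd; rewrite e0 /= hd ft.
    case: M0 => _ _ c2 s' s'N; rewrite e0 /=.
    by move: (c2 _ s'N); rewrite /srep; case: (c.2 _).
  have M2 : matches (b.+1 + csize p1) (srep st') (iter n (@tm_step _ prog_machine) (tm_step c)).
    apply: IH => //; last lia.
    move=> i li; have [|l e] := H i.+1 _; first lia.
    by rewrite addSnnS; split=> //; rewrite e /= nth_cat size_compile li.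
  have [|l2 e2] := H (csize p1).+1 _; first lia.
  rewrite /= nth_cat size_compile ltnn subnn /= addnS -addSn in l2 e2.
  rewrite -iterS iterSr; apply: (step_matches l2 M2); rewrite ?e2 //=; first lia.
  case: M2 => _ _ c2 s' s'N.
  by move: (c2 _ s'N); rewrite /srep; case: (_ (tape_ix s')).
- move=> s f p1 p2 st n st' ft _ IH b c H le M0.
  have [l0 e0] := H 0 isT; rewrite addn0 /= in l0 e0.
  have sN : s \in names by apply: (names_code l0); rewrite e0 /= inE eqxx.
  have M1 : matches (b + csize p1).+2 (srep st) (tm_step c).
    apply: (step_matches l0 M0); last 1 first.
    + case: M0 => _ _ c2 s' s'N; rewrite e0 /=.
      by move: (c2 _ s'N); rewrite /srep; case: (c.2 _).
    + by case: M0 => _ _ /(_ _ sN) /rep_head hd; rewrite e0 /= hd (negbTE ft).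
    + lia.
  rewrite -iterS iterSr.
  have -> : b + (csize p1 + csize p2).+2 = (b + csize p1).+2 + csize p2 by lia.
  apply: IH => //; last lia.
  move=> i li; have [|l e] := H ((csize p1).+2 + i) _; first lia.
  have E : b + ((csize p1).+2 + i) = (b + csize p1).+2 + i by lia.
  rewrite E in l e; split=> //; rewrite e /= nth_cat size_compile.
  by rewrite ltnNge leqW ?leq_addr //= subSn ?leq_addr //= addKn.
- move=> s p1 st n st1 n' st2 ne _ IH1 _ IH2 b c H le M0.
  have [l0 e0] := H 0 isT; rewrite addn0 /= in l0 e0.
  have sN : s \in names by apply: (names_code l0); rewrite e0 /= inE eqxx.
  have M1 : matches b.+1 (srep st) (tm_step c).
    apply: (step_matches l0 M0) => //.
      case: M0 => _ _ /(_ _ sN) /rep_head hd; rewrite e0 /= hd.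
      by case: (st s) ne.
    case: M0 => _ _ c2 s' s'N; rewrite e0 /=.
    by move: (c2 _ s'N); rewrite /srep; case: (c.2 _).
  have M2 : matches (b.+1 + csize p1) (srep st1) (iter n (@tm_step _ prog_machine) (tm_step c)).
    apply: IH1 => //; last lia.
    move=> i li; have [|l e] := H i.+1 _; first lia.
    by rewrite addSnnS; split=> //; rewrite e /= nth_cat size_compile li.
  have [|l2 e2] := H (csize p1).+1 _; first lia.
  rewrite /= nth_cat size_compile ltnn subnn /= addnS -addSn in l2 e2.
  have M3 : matches b (srep st1) (tm_step (iter n (@tm_step _ prog_machine) (tm_step c))).
    apply: (step_matches l2 M2); rewrite ?e2 //=; first lia.
    case: M2 => _ _ c2 s' s'N.
    by move: (c2 _ s'N); rewrite /srep; case: (_ (tape_ix s')).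
  by move: (IH2 _ _ H le M3); rewrite (addnC n) -iterSr -iterD addSn -iterSr.
- move=> s p1 st ne b c H le M0.
  have [l0 e0] := H 0 isT; rewrite addn0 /= in l0 e0.
  have sN : s \in names by apply: (names_code l0); rewrite e0 /= inE eqxx.
  have E : b + (csize p1).+2 = (b + csize p1).+2 by lia.
  rewrite E; apply: (step_matches l0 M0); last 1 first.
  + case: M0 => _ _ c2 s' s'N; rewrite e0 /=.
    by move: (c2 _ s'N); rewrite /srep; case: (c.2 _).
  + by case: M0 => _ _ /(_ _ sN) /rep_head hd; rewrite e0 /= hd ne.
  + lia.
Qed.

Definition input_stacks (w : seq S) : stacks :=
  fun s => if s == (0, 0) then map inl w else [::].

Lemma prog_machine_verdict w n st t : run p (input_stacks w) n st -> n < t ->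
  tm_verdict prog_machine w t = Some (verdict (ohead (st out))).
Proof.
move=> r lt.
have M0 : matches 0 (srep (input_stacks w)) (tm_init prog_machine w).
  split=> // [|s sN]; first by congr inl; apply/val_inj; rewrite /= inordK.
  rewrite /srep ffunE /input_stacks.
  have -> : (tape_ix s == ord0) = (s == (0, 0)).
    apply/eqP/eqP => [E|->].
      by rewrite -(tape_ixK sN) E.
    by apply/val_inj; rewrite /= inordK.
  case: eqP => _ [|i] //=; first by case: w {r}.
    by case: w {r} => [|a w] //=; rewrite nth_nil.
  by rewrite nth_nil.
have cs : size code = csize p by rewrite size_compile.
have M1 := run_matches r (b := 0) _ _ M0.
have {M1} : matches (csize p) (srep st) (iter n (@tm_step _ prog_machine) (tm_init prog_machine w)).
  by apply: M1 => [i li|]; rewrite add0n cs.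
case=> _ c1 c2.
have E : (iter n.+1 (@tm_step _ prog_machine) (tm_init prog_machine w)).1
       = inr (verdict (ohead (st out))).
  rewrite iterS; move: (iter n _ _) c1 c2 => c c1 c2.
  have ltF : (csize p < size code) = false by rewrite cs ltnn.
  rewrite /tm_step c1 /= inordK ?ltF /= ?cs // ffunE.
  by rewrite (rep_head (c2 out _)) // !inE eqxx orbT.
have halted k c : c.1 = inr (verdict (ohead (st out))) ->
    (iter k (@tm_step _ prog_machine) c).1 = inr (verdict (ohead (st out))).
  by elim: k => //= k IH /IH e; rewrite /tm_step e.
by rewrite /tm_verdict -(subnK lt) iterD halted.
Qed.
End Machine.
End StackPrograms.

(** * Cost bounds for stack programs *)

Definition poly_bounded (f : nat -> nat) :=
  exists c d, forall n, f n <= c * n ^ d + c.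

(** The base [n.+1] is positive, so its powers grow with the exponent and sums can be bounded by
    adding degrees. [poly_boundedW] goes back at the price of a factor 2 ^ d. *)
Lemma poly_boundedP f : poly_bounded f ->
  exists c d, forall n, f n <= c * n.+1 ^ d.
Proof.
move=> [c [d H]]; exists (c + c), d => n; apply: (leq_trans (H n)).
have le : n ^ d <= n.+1 ^ d by case: (d) => // d'; rewrite leq_exp2r.
by rewrite mulnDl leq_add ?leq_mul // leq_pmulr ?expn_gt0.
Qed.

Lemma poly_boundedW f c d : (forall n, f n <= c * n.+1 ^ d) -> poly_bounded f.
Proof.
move=> H; exists (c * 2 ^ d), d => n; apply: (leq_trans (H n)).
case: n => [|n]; first by rewrite exp1n muln1 (leq_trans _ (leq_addl _ _)) // leq_pmulr ?expn_gt0.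
apply: (leq_trans _ (leq_addr _ _)); rewrite -mulnA leq_mul // -expnMn.
by case: d {H} => // d; rewrite leq_exp2r //; lia.
Qed.

Lemma poly_bounded_const k : poly_bounded (fun=> k).
Proof. by exists k, 0 => n; rewrite leq_addl. Qed.

Lemma poly_bounded_id : poly_bounded id.
Proof. by exists 1, 1 => n; rewrite expn1; lia. Qed.

Lemma poly_boundedD f g :
  poly_bounded f -> poly_bounded g -> poly_bounded (fun n => f n + g n).
Proof.
move=> /poly_boundedP[c [d H]] /poly_boundedP[c' [d' H']].
apply: (@poly_boundedW _ (c + c') (d + d')) => n.
rewrite mulnDl leq_add // ?(leq_trans (H n)) ?(leq_trans (H' n)) //.
  by rewrite leq_mul // leq_pexp2l // leq_addr.
by rewrite leq_mul // leq_pexp2l // leq_addl.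
Qed.

Lemma poly_boundedM f g :
  poly_bounded f -> poly_bounded g -> poly_bounded (fun n => f n * g n).
Proof.
move=> /poly_boundedP[c [d H]] /poly_boundedP[c' [d' H']].
apply: (@poly_boundedW _ (c * c') (d + d')) => n.
by rewrite expnD mulnACA leq_mul.
Qed.

(** * Total-correctness rules with time bounds *)

Section StackLogic.
Variable S : finType.
Notation stacks := (stacks S).

Definition runs (p : prog S) (st : stacks) (B : nat) (Q : stacks -> Prop) :=
  exists n st', [/\ run p st n st', n <= B & Q st'].

Lemma runs_weaken p st B B' (Q Q' : stacks -> Prop) :
  runs p st B Q -> B <= B' -> (forall st', Q st' -> Q' st') -> runs p st B' Q'.
Proof.
move=> [n [st' [r le q]]] leB QQ'; exists n, st'; split=> //; last exact: QQ'.
exact: leq_trans leB.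
Qed.

Lemma runs_skip st B (Q : stacks -> Prop) : Q st -> runs (Skip S) st B Q.
Proof. by move=> q; exists 0, st; split=> //; constructor. Qed.

Lemma runs_push s g st B (Q : stacks -> Prop) :
  1 < B -> Q (upd st s (g :: st s)) -> runs (Push s g) st B Q.
Proof. by move=> le q; exists 2, (upd st s (g :: st s)); split=> //; constructor. Qed.

Lemma runs_pop s st B (Q : stacks -> Prop) :
  0 < B -> Q (upd st s (behead (st s))) -> runs (Pop S s) st B Q.
Proof. by move=> le q; exists 1, (upd st s (behead (st s))); split=> //; constructor. Qed.

Lemma runs_xfer s s' st B (Q : stacks -> Prop) : s != s' -> 1 < B ->
  Q (upd (upd st s (behead (st s))) s' (head (cell0 S) (st s) :: st s')) ->
  runs (Xfer S s s') st B Q.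
Proof. by move=> ne le q; do 2!eexists; split; [apply: RunXfer|exact: le|]. Qed.

Lemma runs_seq p q st B1 B2 B Q1 (Q : stacks -> Prop) :
  runs p st B1 Q1 -> (forall st', Q1 st' -> runs q st' B2 Q) -> B1 + B2 <= B ->
  runs (Seq p q) st B Q.
Proof.
move=> [n1 [st1 [r1 le1 q1]]] H le; have [n2 [st2 [r2 le2 q2]]] := H _ q1.
exists (n1 + n2), st2; split=> //; first exact: RunSeq r1 r2.
by apply: leq_trans le; apply: leq_add.
Qed.

Lemma runs_if s (f : option (cell S) -> bool) p q st B (Q : stacks -> Prop) :
  (f (ohead (st s)) -> runs p st B Q) -> (~~ f (ohead (st s)) -> runs q st B Q) ->
  runs (IfTop s f p q) st B.+2 Q.
Proof.
case: (boolP (f _)) => fE H1 H2.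
  have [n [st' [r le Qst]]] := H1 isT.
  by exists n.+2, st'; split=> //; apply: RunIfT.
have [n [st' [r le Qst]]] := H2 isT.
by exists n.+1, st'; split=> //; [apply: RunIfF|apply: leqW].
Qed.

(** The tested stack serves as loop counter: each round shortens it by exactly one, so there are at
    most [k] rounds of cost [B.+2], and the final failing test costs 1. *)
Lemma runs_while s p st k B B' (I Q : stacks -> Prop) :
  I st -> size (st s) <= k ->
  (forall st', I st' -> st' s != [::] ->
     runs p st' B (fun st'' => I st'' /\ (size (st'' s)).+1 = size (st' s))) ->
  (forall st', I st' -> st' s = [::] -> Q st') ->
  k * B.+2 < B' ->
  runs (WhileNE s p) st B' Q.
Proof.
move=> + + Hb HQ; elim: k st B' => [|k IH] st B' Ist les leB.
  have E : st s = [::] by apply/eqP; rewrite -size_eq0; lia.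
  by exists 1, st; split=> //; [apply: RunWhileF|apply: HQ].
have [E|ne] := eqVneq (st s) [::].
  by exists 1, st; split=> //; [apply: RunWhileF|lia|apply: HQ].
have [n [st' [r le [Ist' szE]]]] := Hb _ Ist ne.
have [|n' [st'' [r' le' q]]] := IH st' (k * B.+2).+1 Ist' _ (ltnSn _); first lia.
exists (n + n').+2, st''; split=> //; first exact: RunWhileT r r'.
by move: leB; rewrite mulSn; lia.
Qed.

(** The first component separates the families: arrays, variables, loop counters indexed by nesting
    depth, and scratch stacks. Array 0 is the input stack [(0, 0)]. *)
Definition arr_stack (a : nat) : sname := (0, a).
Definition var_stack (x : nat) : sname := (1, x).
Definition loop_stack (d : nat) : sname := (2, d).
Definition tmp_stack : sname := (3, 0).
Definition ix_stack : sname := (3, 1).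
Definition cap_stack : sname := (3, 2).
Definition flag_stack : sname := (3, 3).
Definition size_stack : sname := (3, 4).

(** Unary notation is affordable because variables never exceed the input length; counting and
    copying become loops over a stack. *)
Definition unary (k : nat) : seq (cell S) := nseq k (cell1 S).

Definition move_all (s s' : sname) : prog S := WhileNE s (Xfer S s s').

Lemma runs_move_all s s' st B (Q : stacks -> Prop) : s != s' ->
  size (st s) * 4 < B ->
  (forall st', st' s = [::] -> st' s' = catrev (st s) (st s') ->
     (forall t, t != s -> t != s' -> st' t = st t) -> Q st') ->
  runs (move_all s s') st B Q.
Proof.
move=> ne leB HQ; pose I (st' : stacks) :=
  catrev (st' s) (st' s') = catrev (st s) (st s') /\
  forall t, t != s -> t != s' -> st' t = st t.
apply: (@runs_while _ _ _ (size (st s)) 2 _ I) => //.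
- move=> st' [E H] ne'; apply: runs_xfer => //.
  rewrite /I /upd !eqxx (negbTE ne); case: (st' s) ne' E => //= c l _ E.
  split=> //; split=> // t ts ts'.
  by rewrite (negbTE ts) (negbTE ts') H.
- by move=> st' [E H] E0; apply: HQ => //; rewrite -E E0.
Qed.

(** Reading a stack destroys it, so its contents travel to [tmp_stack] and back, with one mark
    pushed on [s'] for every cell returned. *)
Definition copy (s s' : sname) : prog S :=
  Seq (move_all s tmp_stack)
      (WhileNE tmp_stack (Seq (Xfer S tmp_stack s) (Push s' (cell1 S)))).

Lemma catrev_unary k l : catrev (unary k) l = unary k ++ l.
Proof.
by rewrite catrevE; congr (_ ++ _); apply: (@eq_from_nth _ (cell1 S));
  rewrite size_rev // => i; rewrite size_nseq => li; rewrite nth_rev ?size_nseq // !nth_nseq li; case: ifP.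
Qed.

Lemma runs_copy s s' st k B (Q : stacks -> Prop) :
  s != tmp_stack -> s' != tmp_stack -> s != s' ->
  st s = unary k -> st tmp_stack = [::] -> 10 * k + 1 < B ->
  (forall st', (forall t, st' t = if t == s' then unary k ++ st s' else st t) ->
     Q st') ->
  runs (copy s s') st B Q.
Proof.
move=> n1 n2 n3 sE tE leB HQ.
have neqs : (((s == tmp_stack) = false) * ((tmp_stack == s) = false)
  * ((s' == tmp_stack) = false) * ((tmp_stack == s') = false)
  * ((s == s') = false) * ((s' == s) = false))%type.
  by do !split; apply/negbTE; rewrite // eq_sym.
(* A transfer with its loop overhead costs 4 per cell on the way out; the extra push makes it 6 on
   the way back. Each loop ends with one failing test. *)
apply: (@runs_seq _ _ _ (4 * k).+1 (6 * k).+1 _ (fun st' => [/\ st' s = [::], st' tmp_stack = unary k &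
   forall t, t != s -> t != tmp_stack -> st' t = st t])); last lia.
  apply: runs_move_all => //; first by rewrite sE size_nseq mulnC.
  by move=> st' -> -> H; split=> //; rewrite sE tE catrev_unary cats0.
move=> st1 [sE1 tE1 H1].
pose I (st' : stacks) := exists i j, [/\ i + j = k, st' tmp_stack = unary i,
  st' s = unary j, st' s' = unary j ++ st s' &
  forall t, t != s -> t != tmp_stack -> t != s' -> st' t = st t].
apply: (@runs_while _ _ _ k 4 _ I).
- exists k, 0; rewrite addn0; split=> //.
    by rewrite H1 // eq_sym.
  by move=> t ts tt _; apply: H1.
- by rewrite tE1 size_nseq.
- move=> st' [i [j [ij tE' sE' s'E H]]] ne.
  case: i => [|i] in ij tE'; first by rewrite tE' in ne.
  apply: (@runs_seq _ _ _ 2 2 _ (eq (upd (upd st' tmp_stack (unary i)) s (unary j.+1)))) => //.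
    by apply: runs_xfer; rewrite // ?tE' ?sE' // eq_sym.
  move=> _ <-; apply: runs_push => //.
  rewrite /I /upd !(neqs, eqxx) tE' s'E; split=> //.
  exists i, j.+1; split=> //; first lia.
  by move=> t ts tt ts'; rewrite (negbTE ts) (negbTE tt) (negbTE ts') H.
- move=> st' [i [j [ij tE' sE' s'E H]]]; rewrite tE'; case: i ij tE' => // ij tE' _.
  apply: HQ => t; case: (eqVneq t s') => [->|ts']; first by rewrite s'E -ij.
  case: (eqVneq t s) => [->|ts]; first by rewrite sE' sE -ij.
  case: (eqVneq t tmp_stack) => [->|tt]; first by rewrite tE' tE.
  exact: H.
- lia.
Qed.
End StackLogic.

(** * Array programs *)

Inductive expr :=
| EVar of nat
| ESize
| EConst of nat
| EAdd of expr & expr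
| EMul of expr & expr.

Section ArrayPrograms.
Variable S : finType.
Notation stacks := (stacks S).
Notation cell := (cell S).

Inductive cmd :=
| CSkip
| CSeq of cmd & cmd
| CSet of nat & expr
| CWrite of nat & expr & cell
| CIf of nat & expr & cell & cmd & cmd
| CRepeat of expr & cmd.

Record memory := Mem { vars : nat -> nat; arrs : nat -> nat -> cell }.

Definition set_var (m : memory) (x k : nat) : memory :=
  Mem (fun y => if y == x then k else vars m y) (arrs m).

Definition set_arr (m : memory) (a i : nat) (g : cell) : memory :=
  Mem (vars m)
      (fun b j => if (b == a) && (j == i) then g else arrs m b j).

Fixpoint eval (N : nat) (v : nat -> nat) (e : expr) : nat :=
  match e with
  | EVar x => v x
  | ESize => N
  | EConst k => k
  | EAdd e1 e2 => eval N v e1 + eval N v e2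
  | EMul e1 e2 => eval N v e1 * eval N v e2
  end.

(* Assignments saturate at the input length [N]: this keeps all variables
   bounded by [N], whence the running time of any command is polynomial. *)
Fixpoint exec (N : nat) (c : cmd) (m : memory) : memory :=
  match c with
  | CSkip => m
  | CSeq c1 c2 => exec N c2 (exec N c1 m)
  | CSet x e => set_var m x (minn (eval N (vars m) e) N)
  | CWrite a e g => set_arr m a (eval N (vars m) e) g
  | CIf a e g c1 c2 =>
      if arrs m a (eval N (vars m) e) == g then exec N c1 m else exec N c2 m
  | CRepeat e c => iter (eval N (vars m) e) (exec N c) m
  end.

Fixpoint expr_bound (e : expr) (N : nat) : nat :=
  match e with
  | EVar _ | ESize => N
  | EConst k => k
  | EAdd e1 e2 => expr_bound e1 N + expr_bound e2 N
  | EMul e1 e2 => expr_bound e1 N * expr_bound e2 N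
  end.

Lemma eval_bound N v e : (forall x, v x <= N) -> eval N v e <= expr_bound e N.
Proof. by move=> H; elim: e => //= *; rewrite ?leq_add ?leq_mul. Qed.

Lemma vars_exec_le N c m :
  (forall x, vars m x <= N) -> forall x, vars (exec N c m) x <= N.
Proof.
elim: c m => //= [c1 IH1 c2 IH2 m H|x e m H y|a e g c1 IH1 c2 IH2 m H|e c IH m H].
- exact/IH2/IH1.
- by case: eqP => // _; apply: geq_minr.
- by case: eqP => _; [apply: IH1|apply: IH2].
- by elim: (eval _ _ _) => //= k; apply: IH.
Qed.

Fixpoint push_n (k : nat) (s : sname) : prog S :=
  if k is k'.+1 then Seq (Push s (cell1 S)) (push_n k' s) else Skip S.

(** [d] is the nesting depth: loop stacks from [d] on are free to serve as counters. Values are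
    pushed in unary on top of [s], so a sum is just two evaluations in a row. *)
Fixpoint eval_prog (d : nat) (e : expr) (s : sname) : prog S :=
  match e with
  | EVar x => copy S (var_stack x) s
  | ESize => copy S size_stack s
  | EConst k => push_n k s
  | EAdd e1 e2 => Seq (eval_prog d e1 s) (eval_prog d e2 s)
  | EMul e1 e2 =>
      Seq (eval_prog d.+1 e1 (loop_stack d))
          (WhileNE (loop_stack d)
             (Seq (Pop S (loop_stack d)) (eval_prog d.+1 e2 s)))
  end.

(** Random access by unloading: the cells before the wanted one go to [tmp_stack], leaving it on
    top. [move_all] puts them back afterwards. *)
Definition seek (d a : nat) (e : expr) : prog S :=
  Seq (eval_prog d e ix_stack)
      (WhileNE ix_stack (Seq (Pop S ix_stack) (Xfer S (arr_stack a) tmp_stack))).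

Definition clear (s : sname) : prog S := WhileNE s (Pop S s).

(** In [CSet] the value is computed before the variable is cleared, as it may depend on it; each
    unit stored consumes a token of [cap_stack], which holds [N] tokens, and this is the saturation.
    In [CIf] the outcome is kept on [flag_stack] because the array must be restored before a branch
    runs. *)
Fixpoint cmd_prog (d : nat) (c : cmd) : prog S :=
  match c with
  | CSkip => Skip S
  | CSeq c1 c2 => Seq (cmd_prog d c1) (cmd_prog d c2)
  | CSet x e =>
      Seq (eval_prog d e ix_stack)
     (Seq (copy S size_stack cap_stack)
     (Seq (clear (var_stack x))
     (Seq (WhileNE ix_stack
             (Seq (Pop S ix_stack)
                  (IfTop cap_stack isSome
                     (Seq (Pop S cap_stack) (Push (var_stack x) (cell1 S)))
                     (Skip S))))
          (clear cap_stack))))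
  | CWrite a e g =>
      Seq (seek d a e)
     (Seq (Pop S (arr_stack a))
     (Seq (Push (arr_stack a) g)
          (move_all S tmp_stack (arr_stack a))))
  | CIf a e g c1 c2 =>
      Seq (seek d a e)
     (Seq (IfTop (arr_stack a) (fun o => odflt (cell0 S) o == g)
             (Push flag_stack (cell1 S)) (Skip S))
     (Seq (move_all S tmp_stack (arr_stack a))
          (IfTop flag_stack isSome
             (Seq (Pop S flag_stack) (cmd_prog d c1))
             (cmd_prog d c2))))
  | CRepeat e c =>
      Seq (eval_prog d.+1 e (loop_stack d))
          (WhileNE (loop_stack d)
             (Seq (Pop S (loop_stack d)) (cmd_prog d.+1 c)))
  end.

Fixpoint expr_cost (e : expr) (N : nat) : nat :=
  match e with
  | EVar _ | ESize => 10 * N + 2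
  | EConst k => 2 * k
  | EAdd e1 e2 => expr_cost e1 N + expr_cost e2 N
  | EMul e1 e2 => expr_cost e1 N + (expr_bound e1 N * (expr_cost e2 N + 3) + 1)
  end.

Definition seek_cost (e : expr) (N : nat) : nat :=
  expr_cost e N + (5 * expr_bound e N + 1).

Fixpoint cmd_cost (c : cmd) (N : nat) : nat :=
  match c with
  | CSkip => 0
  | CSeq c1 c2 => cmd_cost c1 N + cmd_cost c2 N
  | CSet x e => expr_cost e N + (16 * N + 8 * expr_bound e N + 5)
  | CWrite a e g => seek_cost e N + (4 * expr_bound e N + 4)
  | CIf a e g c1 c2 =>
      seek_cost e N + (4 * expr_bound e N + 8 + cmd_cost c1 N + cmd_cost c2 N)
  | CRepeat e c =>
      expr_cost e N + (expr_bound e N * (cmd_cost c N + 3) + 1)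
  end.

Lemma expr_bound_poly e : poly_bounded (expr_bound e).
Proof.
elim: e => [x||k|e1 H1 e2 H2|e1 H1 e2 H2] /=.
- exact: poly_bounded_id.
- exact: poly_bounded_id.
- exact: poly_bounded_const.
- exact: poly_boundedD.
- exact: poly_boundedM.
Qed.

Ltac poly lem := repeat first
  [ assumption | apply: lem | apply: expr_bound_poly | apply: poly_bounded_id
  | apply: poly_bounded_const | apply: poly_boundedD | apply: poly_boundedM ].

Lemma expr_cost_poly e : poly_bounded (expr_cost e).
Proof. by elim: e => [x||k|e1 H1 e2 H2|e1 H1 e2 H2] /=; poly expr_bound_poly. Qed.

Lemma cmd_cost_poly c : poly_bounded (cmd_cost c).
Proof.
rewrite /cmd_cost /seek_cost; elim: c => [|c1 H1 c2 H2|x e|a e g|a e g c1 H1 c2 H2|e c H];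
  poly expr_cost_poly.
Qed.

(** * Correctness and cost of compiled commands *)

Definition frame (d : nat) (v : nat -> nat) (N : nat) (st : stacks) : Prop :=
  [/\ forall x, st (var_stack x) = unary S (v x),
      st size_stack = unary S N,
      st tmp_stack = [::] &
      forall d', d <= d' -> st (loop_stack d') = [::]].

Definition fresh_dst (d : nat) (s : sname) :=
  [/\ forall x, s != var_stack x, s != size_stack, s != tmp_stack &
      forall d', d <= d' -> s != loop_stack d'].

Lemma fresh_ix d : fresh_dst d ix_stack. Proof. by []. Qed.
Lemma fresh_loop d : fresh_dst d.+1 (loop_stack d).
Proof. by split=> // d' le; rewrite xpair_eqE /=; lia. Qed.

Lemma frame_upd d v N st st' s :
  frame d v N st -> fresh_dst d s -> (forall t, t != s -> st' t = st t) ->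
  frame d v N st'.
Proof.
move=> [H1 H2 H3 H4] [F1 F2 F3 F4] E; split=> [x||| d' le].
- by rewrite E ?H1 // eq_sym.
- by rewrite E ?H2 // eq_sym.
- by rewrite E ?H3 // eq_sym.
- by rewrite E ?H4 // eq_sym F4.
Qed.

Lemma frameW d v N st : frame d v N st -> frame d.+1 v N st.
Proof. by move=> [H1 H2 H3 H4]; split=> // d' /ltnW; apply: H4. Qed.

Lemma fresh_dstW d s : fresh_dst d s -> fresh_dst d.+1 s.
Proof. by move=> [H1 H2 H3 H4]; split=> // d' /ltnW; apply: H4. Qed.

Lemma unary_cat k l r : unary S k ++ unary S l ++ r = unary S (k + l) ++ r.
Proof. by rewrite catA /unary cat_nseq -cat_nseq -nseqD. Qed.

Lemma runs_push_n k s st B (Q : stacks -> Prop) : 2 * k <= B ->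
  (forall st', (forall t, st' t = if t == s then unary S k ++ st s else st t) -> Q st') ->
  runs (push_n k s) st B Q.
Proof.
elim: k st B Q => [|k IH] st B Q leB HQ /=.
  by apply: runs_skip; apply: HQ => t; case: eqP => [->|].
apply: (@runs_seq _ _ _ _ 2 (2 * k) _ (eq (upd st s (cell1 S :: st s)))); last lia.
  exact: runs_push.
move=> _ <-; apply: IH => // st' H; apply: HQ => t; rewrite H /upd.
case: eqP => // _; rewrite eqxx -[cell1 S :: st s]/(unary S 1 ++ st s).
by rewrite unary_cat addn1.
Qed.

Lemma runs_eval e d s v N st B (Q : stacks -> Prop) :
  (forall x, v x <= N) -> frame d v N st -> fresh_dst d s -> expr_cost e N <= B ->
  (forall st', (forall t, st' t = if t == s then unary S (eval N v e) ++ st s else st t) ->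
     Q st') ->
  runs (eval_prog d e s) st B Q.
Proof.
move=> vN; elim: e d s st B Q => [x||k|e1 IH1 e2 IH2|e1 IH1 e2 IH2] d s st B Q fr fs leB HQ /=.
- case: (fr) (fs) => H1 H2 H3 H4 [F1 F2 F3 F4].
  apply: runs_copy HQ => //; first by rewrite eq_sym.
  by move: leB (vN x) => /=; lia.
- case: (fr) (fs) => H1 H2 H3 H4 [F1 F2 F3 F4].
  apply: runs_copy HQ => //; first by rewrite eq_sym.
  by move: leB => /=; lia.
- exact: runs_push_n HQ.
- apply: (runs_seq _ _ leB); first exact: (IH1 d s st (expr_cost e1 N) _ fr fs (leqnn _) (fun _ => id)).
  move=> st1 E1; apply: IH2 => //.
    by apply: (frame_upd fr fs) => t /negbTE ne; rewrite E1 ne.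
  move=> st2 E2; apply: HQ => t; rewrite E2 !E1 eqxx; case: eqP => // _.
  by rewrite unary_cat addnC.
- apply: (runs_seq _ _ leB).
    apply: (IH1 d.+1 (loop_stack d) st (expr_cost e1 N) _ _ _ (leqnn _) (fun _ => id)).
      exact: frameW.
    exact: fresh_loop.
  move=> st1 E1; have [F1 F2 F3 F4] := fs; have nel := F4 _ (leqnn _).
  have [H1 H2 H3 H4] := fr.
  pose I (st' : stacks) := exists i j, [/\ i + j = eval N v e1,
    st' (loop_stack d) = unary S i, st' s = unary S (j * eval N v e2) ++ st s &
    forall t, t != loop_stack d -> t != s -> st' t = st t].
  apply: (@runs_while _ _ _ _ (eval N v e1) (expr_cost e2 N + 1) _ I).
  + exists (eval N v e1), 0; rewrite addn0 !E1 eqxx (negbTE nel) mul0n H4 // cats0.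
    by split=> // t /negbTE t1 t2; rewrite E1 t1.
  + by rewrite E1 eqxx H4 // cats0 size_nseq.
  + move=> st2 [i [j [ij lE sE E2]]] ne.
    case: i => [|i] in ij lE; first by rewrite lE in ne.
    apply: (@runs_seq _ _ _ _ 1 (expr_cost e2 N) _ (eq (upd st2 (loop_stack d) (unary S i)))); last lia.
      by apply: runs_pop => //; rewrite lE.
    move=> _ <-; apply: IH2 => //.
    * have fr2 : frame d.+1 v N st2.
        apply: (frame_upd (frameW (frame_upd fr fs (st' := upd st s (st2 s)) _)) (fresh_loop d)).
          by move=> t /negbTE ne'; rewrite /upd ne'.
        by move=> t ne'; rewrite /upd; case: eqP => [->|/eqP ne2] //; apply: E2.
      by apply: (frame_upd fr2 (fresh_loop d)) => t /negbTE ne'; rewrite /upd ne'.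
    * exact: fresh_dstW.
    move=> st3 E3; split.
      exists i, j.+1; split; first lia.
      * by rewrite E3 eq_sym (negbTE nel) /upd eqxx.
      * by rewrite E3 eqxx /upd (negbTE nel) sE unary_cat mulSn.
      * move=> t t1 t2; rewrite E3 (negbTE t2) /upd (negbTE t1); exact: E2.
    by rewrite E3 eq_sym (negbTE nel) /upd eqxx lE !size_nseq.
  + move=> st2 [i [j [ij lE sE E2]]]; rewrite lE; case: i ij lE => // ij lE _.
    apply: HQ => t; case: (eqVneq t s) => [->|ts]; first by rewrite sE /= -ij.
    by case: (eqVneq t (loop_stack d)) => [->|tl]; [rewrite lE H4|apply: E2].
  + rewrite addn1 addn3 addn1 ltnS leq_mul //; exact: eval_bound.
Qed.

Definition arr_rep (m : memory) (st : stacks) :=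
  forall a i, nth (cell0 S) (st (arr_stack a)) i = arrs m a i.

Definition mem_rep (d N : nat) (m : memory) (st : stacks) : Prop :=
  [/\ frame d (vars m) N st, arr_rep m st &
      [/\ st ix_stack = [::], st cap_stack = [::] & st flag_stack = [::]]].

Lemma runs_clear s st B (Q : stacks -> Prop) : 3 * size (st s) < B ->
  (forall st', (forall t, st' t = if t == s then [::] else st t) -> Q st') ->
  runs (clear s) st B Q.
Proof.
move=> leB HQ.
apply: (@runs_while _ _ _ _ (size (st s)) 1 _ (fun st' => forall t, t != s -> st' t = st t)) => //.
- move=> st' H ne; apply: runs_pop => //; split=> [t ts|].
    by rewrite /upd (negbTE ts) H.
  by rewrite /upd eqxx; case: (st' s) ne.
- by move=> st' H E; apply: HQ => t; case: eqP => [->|/eqP]; [|apply: H].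
- lia.
Qed.

(** [mkseq] replaces [take] because an index beyond the stack makes the transfers produce [cell0];
    the padding is later restored as genuine cells, which leaves the array read by [arr_rep]
    unchanged. *)
Lemma runs_seek d a e v N st B (Q : stacks -> Prop) :
  (forall x, v x <= N) -> frame d v N st -> st ix_stack = [::] ->
  seek_cost e N <= B ->
  (forall st', st' (arr_stack a) = drop (eval N v e) (st (arr_stack a)) ->
     st' tmp_stack = rev (mkseq (nth (cell0 S) (st (arr_stack a))) (eval N v e)) ->
     (forall t, t != arr_stack a -> t != tmp_stack -> st' t = st t) -> Q st') ->
  runs (seek d a e) st B Q.
Proof.
move=> vN fr ixE leB HQ; apply: (runs_seq _ _ leB).
  exact: (runs_eval vN fr (fresh_ix d) (leqnn _) (fun _ => id)).
move=> st1; rewrite ixE cats0 => E1; set k := eval N v e in HQ E1 *.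
have [H1 H2 H3 H4] := fr.
pose I (st' : stacks) := exists i j, [/\ i + j = k, st' ix_stack = unary S i,
  st' (arr_stack a) = drop j (st (arr_stack a)),
  st' tmp_stack = rev (mkseq (nth (cell0 S) (st (arr_stack a))) j) &
  forall t, t != arr_stack a -> t != tmp_stack -> t != ix_stack -> st' t = st t].
apply: (@runs_while _ _ _ _ k 3 _ I).
- exists k, 0; rewrite addn0 !E1 drop0; split=> //.
  by move=> t _ _ /negbTE ne; rewrite E1 ne.
- by rewrite E1 /= size_nseq.
- move=> st2 [i [j [ij ixE2 aE tE E2]]] ne.
  case: i => [|i] in ij ixE2; first by rewrite ixE2 in ne.
  apply: (@runs_seq _ _ _ _ 1 2 _ (eq (upd st2 ix_stack (unary S i)))) => //.
    by apply: runs_pop => //; rewrite ixE2.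
  move=> _ <-; apply: runs_xfer => //; rewrite ixE2 !size_nseq; split=> //.
  exists i, j.+1; split=> //; first lia.
  + by rewrite /upd /= eqxx /= aE -drop1 drop_drop add1n.
  + rewrite /upd /= aE tE /= mkseqS rev_rcons; congr (_ :: _).
    by rewrite -nth0 nth_drop addn0.
  + by move=> t t1 t2 t3; rewrite /upd (negbTE t1) (negbTE t2) (negbTE t3) E2.
- move=> st2 [i [j [ij ixE2 aE tE E2]]]; rewrite ixE2; case: i ij ixE2 => // ij ixE2 _.
  apply: HQ; rewrite -?ij // => t t1 t2.
  by case: (eqVneq t ix_stack) => [->|t3]; [rewrite ixE ixE2|apply: E2].
- by move: (eval_bound e vN); rewrite -/k; lia.
Qed.

Lemma mem_rep_restore d N m st st' : mem_rep d N m st -> arr_rep m st' ->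
  (forall t, (forall a, t != arr_stack a) -> st' t = st t) ->
  mem_rep d N m st'.
Proof.
move=> [[F1 F2 F3 F4] ar [E1 E2 E3]] ar' H; split=> //.
  by split=> [x|||d' le]; rewrite H ?F1 ?F2 ?F3 ?F4.
by split; rewrite H.
Qed.

Lemma nth_mkseq_cat (s r : seq cell) k i :
  nth (cell0 S) (mkseq (nth (cell0 S) s) k ++ r) i =
  if i < k then nth (cell0 S) s i else nth (cell0 S) r (i - k).
Proof. by rewrite nth_cat size_mkseq; case: ltnP => // lt; rewrite nth_mkseq. Qed.

(** The second conclusion protects enclosing loops: a command at depth [d] leaves the counters of
    smaller depth as they were. *)
Lemma runs_cmd c d N m st :
  (forall x, vars m x <= N) -> mem_rep d N m st ->
  runs (cmd_prog d c) st (cmd_cost c N)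
    (fun st' => mem_rep d N (exec N c m) st' /\
                forall d', d' < d -> st' (loop_stack d') = st (loop_stack d')).
Proof.
elim: c d m st => [|c1 IH1 c2 IH2|x e|a e g|a e g c1 IH1 c2 IH2|e c IH] d m st mN mr /=.
- exact: runs_skip.
- apply: (runs_seq (IH1 _ _ _ mN mr) _ (leqnn _)) => st1 [mr1 E1].
  apply: (runs_weaken (IH2 _ _ _ (vars_exec_le _ mN) mr1)) => // st2 [mr2 E2].
  by split=> // d' lt; rewrite E2 ?E1.
- have [fr ar [E1 E2 E3]] := mr; have [F1 F2 F3 F4] := fr.
  apply: (runs_seq _ _ (leqnn _)); first exact: (runs_eval mN fr (fresh_ix d) (leqnn _) (fun _ => id)).
  move=> st1; rewrite E1 cats0 => H1; set k := eval N (vars m) e in H1 *.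
  have kle : k <= expr_bound e N by apply: eval_bound.
  apply: (@runs_seq _ _ _ _ (10 * N + 2) (6 * N + 8 * expr_bound e N + 3) _
    (fun st' => forall t, st' t = if t == ix_stack then unary S k else
       if t == cap_stack then unary S N else st t)); last lia.
    apply: (@runs_copy _ _ _ _ N) => //; rewrite ?H1 //; first lia.
    move=> st' H t; rewrite H !H1 /= E2 cats0.
    by case: (eqVneq t cap_stack) => [->|].
  move=> st2 H2.
  apply: (@runs_seq _ _ _ _ (3 * N + 1) (3 * N + 8 * expr_bound e N + 2) _
    (fun st' => forall t, st' t = if t == ix_stack then unary S k else
       if t == cap_stack then unary S N else if t == var_stack x then [::] else st t)); last lia.
    apply: runs_clear; first by rewrite H2 /= F1 size_nseq; move: (mN x); lia.
    move=> st' H t; rewrite H !H2.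
    by case: (eqVneq t (var_stack x)) => [->|].
  move=> st3 H3.
  apply: (@runs_seq _ _ _ _ (8 * expr_bound e N + 1) (3 * N + 1) _
    (fun st' => (exists j, st' cap_stack = unary S j /\ j <= N) /\
       forall t, t != cap_stack -> st' t = if t == var_stack x then unary S (minn k N) else st t)); last lia.
    pose I (st' : stacks) := exists i j, [/\ i + j = k, st' ix_stack = unary S i,
      st' cap_stack = unary S (N - j), st' (var_stack x) = unary S (minn j N) &
      forall t, t != ix_stack -> t != cap_stack -> t != var_stack x -> st' t = st t].
    apply: (@runs_while _ _ _ _ k 6 _ I).
    + exists k, 0; rewrite !H3 /= eqxx subn0 addn0 min0n; split=> //.
      by move=> t /negbTE t1 /negbTE t2 /negbTE t3; rewrite H3 t1 t2 t3.
    + by rewrite H3 size_nseq.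
    + move=> st' [i [j [ij iE cE vE E]]] ne.
      case: i => [|i] in ij iE; first by rewrite iE in ne.
      apply: (@runs_seq _ _ _ _ 1 5 _ (eq (upd st' ix_stack (unary S i)))) => //.
        by apply: runs_pop => //; rewrite iE.
      move=> _ <-; apply: runs_if; rewrite /upd /= cE.
        case: (ltnP j N) => [lt _|le]; last by have -> : N - j = 0 by lia.
        apply: (@runs_seq _ _ _ _ 1 2 _ (eq (upd (upd st' ix_stack (unary S i)) cap_stack (unary S (N - j.+1))))) => //.
          apply: runs_pop => //; rewrite /upd /= cE.
          by have -> : N - j = (N - j.+1).+1 by lia.
        move=> _ <-; apply: runs_push => //; rewrite /upd /= iE !size_nseq; split=> //.
        exists i, j.+1; rewrite /= eqxx vE; split=> //; first lia.
          have -> : minn j.+1 N = j.+1 by lia.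
          by have -> : minn j N = j by lia.
        by move=> t /negbTE t1 /negbTE t2 /negbTE t3; rewrite t3 t2 t1 E ?t1 ?t2 ?t3.
      case: (ltnP j N) => [lt|le _].
        by have -> : N - j = (N - j).-1.+1 by lia.
      apply: runs_skip; rewrite /= iE !size_nseq; split=> //.
      exists i, j.+1; rewrite /= vE cE; split=> //; first lia.
      * by congr unary; lia.
      * by congr unary; lia.
      * by move=> t /negbTE t1 /negbTE t2 /negbTE t3; rewrite t1 E ?t1 ?t2 ?t3.
    + move=> st' [i [j [ij iE cE vE E]]]; rewrite iE; case: i ij iE => // ij iE _.
      split; first by exists (N - j); rewrite leq_subr.
      move=> t t2; case: (eqVneq t (var_stack x)) => [->|t3]; first by rewrite vE -ij.
      case: (eqVneq t ix_stack) => [->|t1]; first by rewrite iE E1.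
      exact: E.
    + lia.
  move=> st4 [[j [cE jN]] H4]; apply: runs_clear; first by rewrite cE size_nseq; lia.
  move=> st5 H5; split; last by move=> d' lt; rewrite H5 /= H4.
  split.
  + split=> [y|||d' le]; rewrite H5 /= H4 //=; last exact: F4.
    by rewrite xpair_eqE /=; case: eqP.
  + by move=> b i; rewrite H5 /= H4 //=; apply: ar.
  + by rewrite !H5 /= !H4.
- have [fr ar [E1 E2 E3]] := mr; have [F1 F2 F3 F4] := fr.
  set k := eval N (vars m) e; have kle : k <= expr_bound e N by apply: eval_bound.
  apply: (runs_seq _ _ (leqnn _)).
    exact: (runs_seek (a := a) mN fr E1 (leqnn _) (fun st' x y z => conj x (conj y z))).
  move=> st1 [aE [tE H1]].
  apply: (@runs_seq _ _ _ _ 1 (4 * expr_bound e N + 3) _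
     (eq (upd st1 (arr_stack a) (drop k.+1 (st (arr_stack a)))))); last lia.
    by apply: runs_pop => //; rewrite aE -drop1 drop_drop add1n.
  move=> _ <-.
  apply: (@runs_seq _ _ _ _ 2 (4 * expr_bound e N + 1) _
     (eq (upd (upd st1 (arr_stack a) (drop k.+1 (st (arr_stack a)))) (arr_stack a)
            (g :: drop k.+1 (st (arr_stack a)))))); last lia.
    by apply: runs_push => //; rewrite /upd eqxx.
  move=> _ <-; apply: runs_move_all => //.
    by rewrite /upd /= tE size_rev size_mkseq -/k; lia.
  rewrite /upd /= !eqxx tE catrevE revK => st2 tE2 aE2 H2.
  have H t : t != arr_stack a -> st2 t = st t.
    move=> ta; case: (eqVneq t tmp_stack) => [->|tt]; first by rewrite tE2 F3.
    by rewrite H2 // (negbTE ta) H1.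
  split; last by move=> d' lt; rewrite H.
  split.
  + by split=> [x|||d' le]; rewrite H //; apply: F4.
  + move=> b i /=; case: (eqVneq b a) => [->|ba] /=; last by rewrite H // xpair_eqE.
    rewrite aE2 nth_mkseq_cat -/k; case: (ltngtP i k) => [lt|lt|->]; rewrite ?subnn //=.
  have -> : i - k = (i - k.+1).+1 by lia.
    by rewrite /= nth_drop -ar; congr nth; lia.
  + by rewrite !H.
- have [fr ar [E1 E2 E3]] := mr; have [F1 F2 F3 F4] := fr.
  set k := eval N (vars m) e; have kle : k <= expr_bound e N by apply: eval_bound.
  apply: (runs_seq _ _ (leqnn _)).
    exact: (runs_seek (a := a) mN fr E1 (leqnn _) (fun st' x y z => conj x (conj y z))).
  move=> st1 [aE [tE H1]].
  apply: (@runs_seq _ _ _ _ 4 (4 * expr_bound e N + 4 + cmd_cost c1 N + cmd_cost c2 N) _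
     (fun st' => forall t, st' t = if t == flag_stack
        then unary S (arrs m a k == g) else st1 t)); last lia.
    have hd : odflt (cell0 S) (ohead (st1 (arr_stack a))) = arrs m a k.
      by rewrite aE -ar -[k in RHS]addn0 -nth_drop nth0; case: (drop _ _).
    apply: runs_if; rewrite hd => gE.
      apply: runs_push => // t; rewrite /upd gE H1 // E3.
      by case: eqP.
    by apply: runs_skip => t; rewrite (negbTE gE); case: eqP => // ->; rewrite H1 // E3.
  move=> st2 H2.
  apply: (@runs_seq _ _ _ _ (4 * expr_bound e N + 1) (3 + cmd_cost c1 N + cmd_cost c2 N) _
     (fun st' => [/\ st' flag_stack = unary S (arrs m a k == g),
        forall t, (forall b, t != arr_stack b) -> t != flag_stack -> st' t = st t
        & arr_rep m st'])); last lia.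
    apply: runs_move_all => //.
      by rewrite H2 /= tE size_rev size_mkseq -/k; lia.
    move=> st3; rewrite !H2 /= tE catrevE revK aE => tE3 aE3 H3; split=> //.
    + by rewrite H3 // H2.
    + move=> t ta tf; case: (eqVneq t tmp_stack) => [->|tt]; first by rewrite tE3 F3.
      by rewrite H3 ?ta // H2 (negbTE tf) H1.
    + move=> b i; case: (eqVneq b a) => [->|ba]; last first.
        by rewrite H3 ?xpair_eqE ?ba // H2 /= H1 ?xpair_eqE ?ba.
      rewrite aE3 nth_mkseq_cat -/k; case: ltnP => le; first exact: ar.
      by rewrite nth_drop subnKC.
  move=> st3 [fE H3 ar3].
  have -> : 3 + cmd_cost c1 N + cmd_cost c2 N = (1 + cmd_cost c1 N + cmd_cost c2 N).+2 by lia.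
  apply: runs_if; rewrite fE; case: (arrs m a k == g) fE => //= fE _.
    apply: (@runs_seq _ _ _ _ 1 (cmd_cost c1 N) _ (eq (upd st3 flag_stack [::]))); last lia.
      by apply: runs_pop => //; rewrite fE.
    move=> _ <-; have mr3 : mem_rep d N m (upd st3 flag_stack [::]).
      apply: (mem_rep_restore mr) => [b i|t ta]; rewrite /upd; first exact: ar3.
      by case: eqP => [->|/eqP tf]; rewrite ?E3 ?H3.
    apply: (runs_weaken (IH1 _ _ _ mN mr3)) => // st4 [mr4 H4]; split=> // d' lt.
    by rewrite H4 // /upd /= H3.
  have mr3 : mem_rep d N m st3.
    apply: (mem_rep_restore mr) => // t ta.
    by case: (eqVneq t flag_stack) => [->|tf]; [rewrite fE E3|rewrite H3].
  apply: (runs_weaken (IH2 _ _ _ mN mr3)) => [|st4 [mr4 H4]]; first lia.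
  by split=> // d' lt; rewrite H4 // H3.
- have [fr ar [E1 E2 E3]] := mr; have [F1 F2 F3 F4] := fr.
  set k := eval N (vars m) e; have kle : k <= expr_bound e N by apply: eval_bound.
  apply: (runs_seq _ _ (leqnn _)).
    exact: (runs_eval mN (frameW fr) (fresh_loop d) (leqnn _) (fun _ => id)).
  move=> st1; rewrite F4 // cats0 -/k => H1.
  (* During the loop the counter occupies [loop_stack d], which [mem_rep d] wants empty; the
     invariant therefore speaks of the state with that stack cleared. *)
  pose I (st' : stacks) := exists i j, [/\ i + j = k, st' (loop_stack d) = unary S i,
    mem_rep d N (iter j (exec N c) m) (upd st' (loop_stack d) [::]) &
    forall d', d' < d -> st' (loop_stack d') = st (loop_stack d')].
  have vle j x : vars (iter j (exec N c) m) x <= N.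
    by elim: j x => //= j IHj; apply: vars_exec_le.
  apply: (@runs_while _ _ _ _ k (cmd_cost c N + 1) _ I).
  + exists k, 0; rewrite addn0 H1 eqxx; split=> //.
      apply: (mem_rep_restore mr) => [b i|t ta]; first by rewrite /upd /= H1 /=; apply: ar.
      rewrite /upd; case: eqP => [->|/eqP tl]; first by rewrite F4.
      by rewrite H1 (negbTE tl).
    by move=> d' lt; rewrite H1 ifF // xpair_eqE /=; lia.
  + by rewrite H1 eqxx size_nseq.
  + move=> st2 [i [j [ij lE [[G1 G2 G3 G4] ar2 [G5 G6 G7]] H2]]] ne.
    case: i => [|i] in ij lE; first by rewrite lE in ne.
    apply: (@runs_seq _ _ _ _ 1 (cmd_cost c N) _ (eq (upd st2 (loop_stack d) (unary S i)))); last lia.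
      by apply: runs_pop => //; rewrite lE.
    move=> _ <-.
    have mr2 : mem_rep d.+1 N (iter j (exec N c) m) (upd st2 (loop_stack d) (unary S i)).
      split=> //; split=> // d' lt; move: (G4 d' (ltnW lt)).
      by rewrite /upd ifF ?[in X in _ -> X]ifF // xpair_eqE /=; lia.
    apply: (runs_weaken (IH _ _ _ (vle j) mr2)) => // st3 [[[K1 K2 K3 K4] ar3 [K5 K6 K7]] H3].
    have lE3 : st3 (loop_stack d) = unary S i by rewrite H3 // /upd eqxx.
    split; last by rewrite lE3 lE !size_nseq.
    exists i, j.+1; split=> //; first lia.
      split=> //; split=> // d' le; rewrite /upd; case: eqP => // /eqP; rewrite xpair_eqE /= => nd.
      by apply: K4; lia.
    move=> d' lt; rewrite H3; last lia.
    by rewrite /upd ifF ?H2 // xpair_eqE /=; lia.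
  + move=> st2 [i [j [ij lE mr2 H2]]]; rewrite lE; case: i ij lE => // ij lE _.
    rewrite add0n in ij; rewrite -ij; split=> //.
    case: mr2 => [[G1 G2 G3 G4] ar2 [G5 G6 G7]]; split=> //; split=> // d' le.
    by case: (eqVneq d' d) => [->//|ne]; move: (G4 _ le); rewrite /upd xpair_eqE (negbTE ne).
  + by rewrite addn1 addn3 addn1 ltnS leq_mul.
Qed.

Definition size_prog : prog S :=
  Seq (WhileNE (arr_stack 0)
         (Seq (Xfer S (arr_stack 0) tmp_stack) (Push size_stack (cell1 S))))
      (move_all S tmp_stack (arr_stack 0)).

Definition init_mem (w : seq S) : memory :=
  Mem (fun=> 0) (fun a i => if a == 0 then nth (cell0 S) (map inl w) i else cell0 S).

Lemma runs_size w : runs size_prog (input_stacks w) (10 * size w + 2)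
  (mem_rep 0 (size w) (init_mem w)).
Proof.
apply: (@runs_seq _ _ _ _ (6 * size w + 1) (4 * size w + 1) _
  (fun st' => forall t, st' t = if t == tmp_stack then rev (map inl w) else
     if t == size_stack then unary S (size w) else [::])); last lia.
  pose I (st' : stacks) := exists l r, [/\ l ++ r = w, st' (arr_stack 0) = map inl r,
    st' tmp_stack = rev (map inl l), st' size_stack = unary S (size l) &
    forall t, t != arr_stack 0 -> t != tmp_stack -> t != size_stack -> st' t = [::]].
  apply: (@runs_while _ _ _ _ (size w) 4 _ I).
  - exists [::], w; split=> // t /negbTE ta _ _.
    by rewrite /input_stacks -/(arr_stack 0) ta.
  - by rewrite /input_stacks /= size_map.
  - move=> st' [l [r [E aE tE sE H]]] ne; case: r => [|y r] in E aE; first by rewrite aE in ne.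
    apply: (@runs_seq _ _ _ _ 2 2 _ (eq (upd (upd st' (arr_stack 0) (map inl r))
       tmp_stack (inl y :: rev (map inl l))))) => //.
      by apply: runs_xfer => //; rewrite aE tE.
    move=> _ <-; apply: runs_push => //; rewrite /upd /= aE; split=> //.
    exists (rcons l y), r; rewrite cat_rcons; split=> //.
    + by rewrite map_rcons rev_rcons.
    + by rewrite size_rcons sE.
    + by move=> t /negbTE t1 /negbTE t2 /negbTE t3; rewrite t1 t2 t3 H ?t1 ?t2 ?t3.
  - move=> st' [l [r [E aE tE sE H]]]; rewrite aE; case: r E aE => // E aE _ t.
    rewrite cats0 in E; rewrite -E.
    case: (eqVneq t tmp_stack) => [->|t1] //; case: (eqVneq t size_stack) => [->|t2] //.
    by case: (eqVneq t (arr_stack 0)) => [->|t3]; [rewrite aE|apply: H].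
  - lia.
move=> st1 H1; apply: runs_move_all => //.
  by rewrite H1 /= size_rev size_map; lia.
rewrite !H1 /= catrevE revK cats0 => st2 tE aE H2.
split; first by split=> [x|||d' le] //; rewrite H2 ?H1.
  move=> a i /=; case: eqP => [->|/eqP ne]; first by rewrite aE.
  by rewrite H2 ?xpair_eqE ?ne // H1 /= nth_nil.
by rewrite !H2 // !H1.
Qed.

End ArrayPrograms.

(** What remains for a given problem is to write one array command. The answer is yes unless cell 0
    of [out] has been set, which suits a last stage that looks for a violation. *)
Theorem cmd_polytime (P : decision_problem) (c : cmd (alphabet P)) (out : nat) :
  (forall x : instance P,
     let w := encode x in
     arrs (exec (size w) c (init_mem w)) out 0 != cell1 (alphabet P) <-> yes_instance x) ->
  polytime_solvable P.
Proof.
move=> H.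
pose p := Seq (size_prog (alphabet P)) (cmd_prog 0 c).
(* The last 1 pays for the step that reads the verdict. *)
have [k [d kd]] : poly_bounded (fun N => 10 * N + 2 + cmd_cost c N + 1).
  apply: poly_boundedD (poly_bounded_const 1); apply: poly_boundedD (cmd_cost_poly c).
  apply: poly_boundedD (poly_bounded_const 2).
  exact: poly_boundedM (poly_bounded_const 10) poly_bounded_id.
exists (prog_machine p (arr_stack out) (fun o => odflt (cell0 _) o != cell1 _)), k, d => x.
set w := encode x.
have [n1 [st1 [r1 le1 mr1]]] := runs_size w.
have v0 y : vars (init_mem w) y <= size w by [].
have [n2 [st2 [r2 le2 [mr2 _]]]] := runs_cmd c v0 mr1.
rewrite (prog_machine_verdict (t := k * size w ^ d + k) _ _ (RunSeq r1 r2)); last first.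
  by move: (kd (size w)); lia.
exists (odflt (cell0 _) (ohead (st2 (arr_stack out))) != cell1 (alphabet P)) => //.
rewrite -H -/w; case: mr2 => _ ar _; rewrite -ar.
by case: (st2 _).
Qed.

(** * Consecutive orderings *)

Section ConsecutiveOrder.
Variables (U : eqType) (J : Type) (X : J -> pred U).

(* In a linear order, closure under these rules says that no [y] outside [X j]
   lies between two elements of [X j]. *)
Definition forcing_closed (D : U -> U -> Prop) :=
  forall j x y z, X j x -> X j z -> ~~ X j y ->
    (D x y -> D z y) /\ (D y x -> D y z).

(** The least forcing-closed relation containing [(a, b)], an analogue of the implication classes in
    the theory of transitive orientations. *)
Inductive forced (a b : U) : U -> U -> Prop :=
| forced_refl : forced a b a b
| forced_left j x y z : X j x -> X j z -> ~~ X j y ->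
    forced a b x y -> forced a b z y
| forced_right j x y z : X j x -> X j z -> ~~ X j y ->
    forced a b y x -> forced a b y z.

Lemma forced_closed a b : forcing_closed (forced a b).
Proof. by move=> j x y z xj zj yj; split; [apply: forced_left xj zj yj|apply: forced_right xj zj yj]. Qed.

Lemma forced_sub (D : U -> U -> Prop) a b x y :
  forcing_closed D -> forced a b x y -> D a b -> D x y.
Proof.
move=> cl; elim=> // {x y} j x y z xj zj yj _ IH /IH H; have [cl1 cl2] := cl j x y z xj zj yj.
  exact: cl1.
exact: cl2.
Qed.

(** Every rule is reversible, by exchanging [x] and [z]. With [forced_sub], a forcing-closed
    relation contains a forcing class entirely or misses it entirely. *)
Lemma forced_sub_inv (D : U -> U -> Prop) a b x y :
  forcing_closed D -> forced a b x y -> D x y -> D a b.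
Proof.
move=> cl; elim=> // {x y} j x y z xj zj yj _ IH H; apply: IH.
  by have [cl1 _] := cl j z y x zj xj yj; apply: cl1.
by have [_ cl2] := cl j z y x zj xj yj; apply: cl2.
Qed.

Lemma forcing_closed_flip (D : U -> U -> Prop) :
  forcing_closed D -> forcing_closed (fun x y => D y x).
Proof. by move=> cl j x y z xj zj yj; have [] := cl j x y z xj zj yj. Qed.

(** Follow a chain from [x] in [X j] to [y] outside. As long as it stays in [X j], its current point
    can replace [x]; the step that leaves [X j] is forced for [z] as well, and the rest of the chain
    is kept. *)
Lemma clos_trans_forcing (D : U -> U -> Prop) :
  forcing_closed D -> forcing_closed (clos_trans U D).
Proof.
move=> cl j x y z xj zj yj; split=> H.
  have {}H : clos_trans_1n U D x y by apply/clos_trans_t1n_iff.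
  elim: H xj yj => {x y} [x y Dxy|x u y Dxu Duy IH] xj yj.
    by have [c1 _] := cl j x y z xj zj yj; apply/t_step/c1.
  case: (boolP (X j u)) => uj; first exact: IH.
  apply: t_trans (t_step _ _ _ _ _) _; last by apply/clos_trans_t1n_iff; exact: Duy.
  by have [c1 _] := cl j x u z xj zj uj; apply: c1.
have {}H : clos_trans_n1 U D y x by apply/clos_trans_tn1_iff.
elim: H xj yj => {x} [x Dyx|u x Dux Dyu IH] xj yj.
  by have [_ c2] := cl j x y z xj zj yj; apply/t_step/c2.
case: (boolP (X j u)) => uj; first exact: IH.
apply: t_trans _ (t_step _ _ _ _ _); first by apply/clos_trans_tn1_iff; exact: Dyu.
by have [_ c2] := cl j x u z xj zj uj; apply: c2.
Qed.

(** * Adding one incomparable pair to a partial order *)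

Section Extension.
Variables (D : U -> U -> Prop) (a b : U).
Hypotheses (D_irr : forall x, ~ D x x)
  (D_trans : forall x y z, D x y -> D y z -> D x z)
  (D_forcing : forcing_closed D) (Dab : ~ D a b) (Dba : ~ D b a).
Hypothesis forced_asym : forall x y, forced a b x y -> ~ forced a b y x.
Let C := forced a b.

(* Triangle lemma: all pairs of [C] see a given [w] in the same way. *)
Lemma forced_triangle x y w : C x y ->
  (~ C x w /\ ~ C w y) <-> (~ C a w /\ ~ C w b).
Proof.
elim=> // {x y} j x y z xj zj yj Cxy IH; have cl := @forced_closed a b j x y w xj.
  rewrite -IH; case: (boolP (X j w)) => wj.
    have Cwy : C w y by have [cl1 _] := cl wj yj; apply: cl1.
    by split=> -[].
  have [c1 c2] := @forced_closed a b j x w z xj zj wj.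
  have [c3 c4] := @forced_closed a b j z w x zj xj wj.
  by split=> -[n1 n2]; (split; last exact: n2) => n; apply: n1; [apply: c1|apply: c3].
rewrite -IH; case: (boolP (X j w)) => wj.
  have Cyw : C y w by have [_ cl2] := cl wj yj; apply: cl2.
  by split=> -[].
have [c1 c2] := @forced_closed a b j x w z xj zj wj.
have [c3 c4] := @forced_closed a b j z w x zj xj wj.
by split=> -[n1 n2]; (split; first exact: n1) => n; apply: n2; [apply: c2|apply: c4].
Qed.

(** Triangle lemma with [w := x]: if [C x z] failed, neither relation in question would link [x] to
    the pair [(y, z)], hence none to [(x, y)], against [C x y]. *)
Lemma forced_trans x y z : C x y -> C y z -> C x z.
Proof.
move=> Cxy Cyz; apply: NNPP => nxz.
have [] // : ~ C x x /\ ~ C x y.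
apply/(forced_triangle _ Cxy)/(forced_triangle _ Cyz).
by split=> //; apply: forced_asym.
Qed.

Lemma forced_notD x y : C x y -> ~ D x y /\ ~ D y x.
Proof.
move=> Cxy; split=> H; first exact/Dab/(forced_sub_inv D_forcing Cxy).
exact/Dba/(forced_sub_inv (forcing_closed_flip D_forcing) Cxy).
Qed.

(** It suffices to get [C x1 x2]. Otherwise take [w := x2]: as [D y1 x2] excludes [C x2 y1], the
    triangle lemma carries this from [(x1, y1)] to [(x2, y2)] and denies [C x2 y2]. *)
Lemma forced_sandwich x1 y1 x2 y2 : C x1 y1 -> D y1 x2 -> C x2 y2 -> C x1 y2.
Proof.
move=> C1 D12 C2; apply: (@forced_trans _ x2) => //; apply: NNPP => n12.
have [] // : ~ C x2 x2 /\ ~ C x2 y2.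
apply/(forced_triangle _ C2)/(forced_triangle _ C1); split=> // C21.
by have [] := forced_notD C21.
Qed.

Definition extension := clos_trans U (fun x y => D x y \/ C x y).

(** Normal form of a chain: at most one [C] step, with an optional [D] step on either side.
    Transitivity of [C] and the sandwich lemma merge any two [C] steps. *)
Lemma extension_spec x y : extension x y ->
  D x y \/ exists u v, [/\ x = u \/ D x u, C u v & v = y \/ D v y].
Proof.
elim=> {x y} [x y [Dxy|Cxy]|x y z _ IH1 _ IH2]; first by left.
  by right; exists x, y; split; [left| |left].
case: IH1 IH2 => [Dxy|[u [v [xu Cuv vy]]]] [Dyz|[u' [v' [yu' Cuv' vz']]]].
- by left; apply: D_trans Dyz.
- right; exists u', v'; split=> //; right.
  by case: yu' => [<-|] //; apply: D_trans.
- right; exists u, v; split=> //; right.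
  by case: vy => [->|Dvy] //; apply: D_trans Dyz.
- right; exists u, v'; split=> //.
  have {vy yu'} [vu'|Dvu'] : v = u' \/ D v u'.
    case: vy yu' => [->|Dvy] [<-|Dyu']; [by left|by right|by right|right].
    exact: D_trans Dyu'.
  + by rewrite vu' in Cuv; apply: forced_trans Cuv'.
  + exact: (forced_sandwich Cuv Dvu' Cuv').
Qed.

(** A cycle in normal form joins its two [D] ends and leaves [C u v] with [v = u] or [D v u];
    antisymmetry of [C] and its disjointness from [D] exclude both. *)
Lemma extension_irr x : ~ extension x x.
Proof.
move/extension_spec => [/D_irr//|[u [v [xu Cuv vx]]]].
have [vu|Dvu] : v = u \/ D v u.
  case: xu vx => [->|Dxu] [->|Dvx]; [by left|by right|by right|right].
  exact: D_trans Dxu.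
- by rewrite vu in Cuv; apply: (forced_asym Cuv).
- by have [] := forced_notD Cuv.
Qed.

Lemma extension_trans x y z : extension x y -> extension y z -> extension x z.
Proof. exact: t_trans. Qed.

Lemma extension_forcing : forcing_closed extension.
Proof.
apply: clos_trans_forcing => j x y z xj zj yj.
have [c1 c2] := D_forcing xj zj yj; have [c3 c4] := @forced_closed a b j x y z xj zj yj.
by split=> -[]; [left; apply: c1|right; apply: c3|left; apply: c2|right; apply: c4].
Qed.

Lemma extension_sub x y : D x y -> extension x y.
Proof. by move=> Dxy; apply: t_step; left. Qed.

Lemma extension_pair : extension a b.
Proof. by apply: t_step; right; apply: forced_refl. Qed.
End Extension.

(** The order given by [k], or its reverse, contains [(a, b)] and hence the whole class. Being free
    to take the reverse is what allows an arbitrary orientation of the pair. *)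
Lemma forced_asym_key (k : U -> nat) a b : injective k -> a <> b ->
  forcing_closed (fun x y => k x < k y) ->
  forall x y, forced a b x y -> ~ forced a b y x.
Proof.
move=> k_inj ab cl x y Cxy Cyx.
have cl' := forcing_closed_flip cl.
case: (ltngtP (k a) (k b)) => [lt|lt|/k_inj//].
  by move: (forced_sub cl Cxy lt) (forced_sub cl Cyx lt); lia.
by move: (forced_sub cl' Cxy lt) (forced_sub cl' Cyx lt); lia.
Qed.
End ConsecutiveOrder.

(** * Products of symmetric groups on intervals *)

Section SymProducts.
Variable U : finType.
Local Open Scope group_scope.

(** Factors are split off from the left, in the order in which the algorithm discards the sets. *)
Fixpoint sym_product (s : seq {set U}) (t : {perm U}) : Prop :=
  if s is A :: s' then exists2 u, u \in Sym A & sym_product s' (u^-1 * t)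
  else t = 1.

Lemma sym_productP (I : eqType) (r : seq I) (X : I -> {set U}) t : uniq r ->
  (exists sigma : I -> {perm U},
     (forall i, sigma i \in Sym (X i)) /\ t = \prod_(i <- r) sigma i)
  <-> sym_product (map X r) t.
Proof.
elim: r t => [|i r IH] t /=.
  move=> _; split=> [[sigma [_ ->]]|->]; first by rewrite big_nil.
  by exists (fun=> 1); rewrite big_nil; split=> // i; apply: group1.
case/andP=> ir ur; split=> [[sigma [H ->]]|[u uA /IH[//|sigma [H E]]]].
  exists (sigma i) => //; apply/IH => //; exists sigma; split=> //.
  by rewrite big_cons mulKg.
exists (fun k => if k == i then u else sigma k); split=> [k|].
  by case: eqP => [->|].
rewrite big_cons eqxx -[t](mulKVg u) E; congr (_ * _).
apply: eq_big_seq => k kr; case: eqP => // ki.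
by rewrite ki (negbTE ir) in kr.
Qed.

Variable lt : rel U.
Hypotheses (lt_irr : irreflexive lt) (lt_trans : transitive lt)
  (lt_total : forall x y, x != y -> lt x y || lt y x).

Lemma lt_asym x y : lt x y -> lt y x = false.
Proof. by move=> xy; apply/negP => yx; move: (lt_trans xy yx); rewrite lt_irr. Qed.

Definition rank (x : U) : nat := #|[set y | lt y x]|.

Lemma rank_lt x y : lt x y -> rank x < rank y.
Proof.
move=> xy; apply/proper_card/properP; split.
  by apply/subsetP => z; rewrite !inE => zx; apply: lt_trans xy.
by exists x; rewrite !inE ?lt_irr.
Qed.

Lemma rank_bound x : rank x <= #|U|.
Proof. exact: max_card. Qed.

Definition sortedness (t : {perm U}) : nat := (\sum_x rank x * rank (t x))%N.

Lemma sortedness_bound t : (sortedness t <= #|U| * (#|U| * #|U|))%N.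
Proof.
rewrite -sum_nat_const; apply: leq_sum => x _; apply: leq_mul; exact: rank_bound.
Qed.

(** Rearrangement inequality: only two summands change, and the gain is (rank b - rank a) * (rank (t
    a) - rank (t b)). *)
Lemma sortedness_swap (t : {perm U}) a b : lt a b -> lt (t b) (t a) ->
  (sortedness t < sortedness (tperm a b * t)%g)%N.
Proof.
move=> ab tab; have ne : b != a by apply/eqP => E; rewrite E lt_irr in ab.
rewrite /sortedness (bigD1 a) // (bigD1 b) //= [X in _ < X](bigD1 a) // [X in _ < _ + X](bigD1 b) //=.
rewrite !permM tpermL tpermR !addnA.
have -> : (\sum_(i | (i != a) && (i != b)) rank i * rank (t i) =
          \sum_(i | (i != a) && (i != b)) rank i * rank ((tperm a b * t)%g i))%N.
  apply: eq_bigr => i /andP[ia ib]; rewrite permM tpermD // eq_sym //.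
rewrite ltn_add2r; move: (rank_lt ab) (rank_lt tab); nia.
Qed.

Definition interval (A : {set U}) :=
  forall a b c, lt a b -> lt b c -> a \in A -> c \in A -> b \in A.

Lemma sym_out (A : {set U}) u x : u \in Sym A -> x \notin A -> u x = x.
Proof. by rewrite inE => uA xA; apply: out_perm uA xA. Qed.

Lemma sym_in (A : {set U}) u x : u \in Sym A -> (u x \in A) = (x \in A).
Proof. by rewrite inE => uA; apply: perm_closed. Qed.

Lemma tperm_sym (A : {set U}) a b : a \in A -> b \in A -> tperm a b \in Sym A.
Proof.
move=> aA bA; rewrite inE; apply/subsetP => x; rewrite inE.
by case: tpermP => [->|->|]; rewrite ?eqxx.
Qed.

(* Products of symmetric groups on intervals form a lower set of the Bruhat
   order. *)
Lemma sym_product_swap s t a b : (forall A, A \in s -> interval A) ->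
  sym_product s t -> lt a b -> lt (t b) (t a) -> sym_product s (tperm a b * t).
Proof.
elim: s t a b => [|A s IH] t a b iA /=.
  by move=> -> /lt_asym; rewrite !perm1 => ->.
move=> [u uA tu] ab tab.
have intA : interval A by apply: iA; rewrite inE eqxx.
(* When [a] and [b] both lie in [A], the first factor absorbs the transposition and the rest stays
   the same. *)
have swap v : v \in Sym A -> sym_product s (v^-1 * t) -> a \in A -> b \in A ->
    exists2 w, w \in Sym A & sym_product s (w^-1 * (tperm a b * t)).
  move=> vA H aA bA; exists (tperm a b * v); first by rewrite groupM ?tperm_sym.
  by rewrite invMg tpermV -mulgA (mulgA (tperm a b)) tperm2 mul1g.
(* If [u] keeps the order, the inversion comes from the rest at [u a], [u b], and induction applies
   there. If [u] reverses it, both points lie in [A]: a point outside is fixed, and the other would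
   have to cross it while staying in the interval. *)
case: (boolP (lt (u a) (u b))) => uab.
  exists u => //; have -> : u^-1 * (tperm a b * t) = tperm (u a) (u b) * (u^-1 * t).
    by rewrite -tpermJ conjgE !mulgA mulgK.
  apply: IH => //; first by move=> B Bs; apply: iA; rewrite inE Bs orbT.
  by rewrite !permM !permK.
suff [aA bA] : a \in A /\ b \in A by apply: (swap u).
have ne : u b != u a by rewrite (inj_eq perm_inj); apply/eqP => E; rewrite E lt_irr in ab.
have {uab} uba : lt (u b) (u a) by move: (lt_total ne); rewrite (negbTE uab) orbF.
case: (boolP (a \in A)) => aA; case: (boolP (b \in A)) => bA //; exfalso.
- move: uba; rewrite (sym_out uA bA) => uba; move/negP: bA; apply.
  by apply: (intA a _ (u a)) => //; rewrite sym_in.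
- move: uba; rewrite (sym_out uA aA) => uba; move/negP: aA; apply.
  by apply: (intA (u b) _ b) => //; rewrite sym_in.
- by move: uba; rewrite !(sym_out uA) // => /lt_asym; rewrite ab.
Qed.

Definition sorted_on (A : {set U}) (t : {perm U}) :=
  forall a b, a \in A -> b \in A -> lt a b -> ~~ lt (t b) (t a).

(** For the least moved point x, both u x and u^-1 x lie above x; monotonicity at x < u^-1 x then
    gives u x < x. *)
Lemma monotone_sym_id (A : {set U}) u : u \in Sym A ->
  (forall a b, a \in A -> b \in A -> lt a b -> lt (u a) (u b)) -> u = 1.
Proof.
move=> uA mono; apply/permP => x0; rewrite perm1; apply/eqP/negPn/negP => nx0.
have [x nx xmin] := @arg_minnP _ x0 (fun x => u x != x) rank nx0.
have low y : lt y x -> u y = y.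
  move=> yx; apply/eqP/negPn/negP => ny; move: (xmin y ny) (rank_lt yx); lia.
have xA : x \in A by apply/negPn/negP => /(sym_out uA) E; rewrite E eqxx in nx.
have xux : lt x (u x).
  case/orP: (lt_total nx) => // uxx; move: (low _ uxx) => /perm_inj E.
  by rewrite E eqxx in nx.
have nz : x != u^-1 x by apply/eqP => E; move: nx; rewrite {1}E permKV eqxx.
have xz : lt x (u^-1 x).
  case/orP: (lt_total nz) => // zx; move: (low _ zx); rewrite permKV => E.
  by rewrite {1}E eqxx in nz.
have zA : u^-1 x \in A by rewrite -(sym_in _ uA) permKV.
by move: (mono _ _ xA zA xz); rewrite permKV => /lt_asym; rewrite xux.
Qed.

(** While the rest [u^-1 * t] has an inversion inside [A], swap it: the rest stays in the product by
    [sym_product_swap], [u] stays in [Sym A], and sortedness rises. In the end [t] and the rest are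
    both sorted on [A], so [u^-1] is monotone there and is the identity. *)
Lemma sym_product_sorted A s t : (forall B, B \in s -> interval B) ->
  sorted_on A t -> (sym_product (A :: s) t <-> sym_product s t).
Proof.
move=> iS tS; split; last by move=> H; exists 1; rewrite ?group1 // invg1 mul1g.
move=> [u uA H].
have [k] := ubnP (#|U| * (#|U| * #|U|) - sortedness (u^-1 * t)%g)%N.
elim: k u uA H => // k IH u uA H lek.
case: (boolP [exists a, exists b, [&& a \in A, b \in A, lt a b &
    lt ((u^-1 * t) b) ((u^-1 * t) a)]]).
  case/existsP=> a /existsP[b /and4P[aA bA ab tab]].
  apply: (IH (u * tperm a b)).
  - by rewrite groupM ?tperm_sym.
  - rewrite invMg tpermV -mulgA; exact: sym_product_swap.
  - rewrite invMg tpermV -mulgA.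
    move: (sortedness_swap ab tab) (sortedness_bound (tperm a b * (u^-1 * t))).
    move=> s1 s2; rewrite -ltnS; apply: leq_trans lek; rewrite ltnS; apply: ltn_sub2l => //.
    exact: leq_trans s1 s2.
move/existsPn => sortu; suff E : u = 1 by rewrite E invg1 mul1g in H.
have mono a b : a \in A -> b \in A -> lt a b -> lt (u^-1 a) (u^-1 b).
  move=> aA bA ab.
  have ne : u^-1 a != u^-1 b by rewrite (inj_eq perm_inj); apply/eqP => E; rewrite E lt_irr in ab.
  case/orP: (lt_total ne) => // ba.
  have uVA : u^-1 \in Sym A by rewrite groupV.
  have n1 : ~~ lt (t (u^-1 a)) (t (u^-1 b)) by apply: tS; rewrite ?sym_in.
  have := sortu a; rewrite negb_exists => /forallP/(_ b).
  rewrite aA bA ab !permM /= => n2.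
  have ne' : t (u^-1 a) != t (u^-1 b) by rewrite (inj_eq perm_inj).
  by move: (lt_total ne'); rewrite (negbTE n1) (negbTE n2).
have /monotone_sym_id/(_ mono) E : u^-1 \in Sym A by rewrite groupV.
by rewrite -[u]invgK E invg1.
Qed.

(** The first group absorbs transpositions of its own set, so sorting the target inside [A] does not
    change the answer. *)
Lemma sym_product_tperm (A : {set U}) s t a b : a \in A -> b \in A ->
  sym_product (A :: s) (tperm a b * t) <-> sym_product (A :: s) t.
Proof.
suff imp t' : a \in A -> b \in A ->
    sym_product (A :: s) t' -> sym_product (A :: s) (tperm a b * t').
  move=> aA bA; split; last exact: imp.
  by move/(imp _ aA bA); rewrite mulgA tperm2 mul1g.
move=> aA bA [u uA H]; exists (tperm a b * u); first by rewrite groupM ?tperm_sym.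
by rewrite invMg tpermV -mulgA (mulgA (tperm a b)) tperm2 mul1g.
Qed.
End SymProducts.

(** * Loops *)

Section Macros.
Variables (S : finType) (N : nat).
Notation cmd := (cmd S).
Notation memory := (memory S).
Notation arrays := (nat -> nat -> cell S).
Notation exec := (@exec S N).

Definition CFor (x : nat) (e : expr) (c : cmd) : cmd :=
  CSeq (CSet _ x (EConst 0))
       (CRepeat e (CSeq c (CSet _ x (EAdd (EVar x) (EConst 1))))).

Fixpoint assigned (c : cmd) : seq nat :=
  match c with
  | CSkip | CWrite _ _ _ => [::]
  | CSeq c1 c2 | CIf _ _ _ c1 c2 => assigned c1 ++ assigned c2
  | CSet x _ => [:: x]
  | CRepeat _ c => assigned c
  end.

Lemma vars_exec c m x : x \notin assigned c -> vars (exec c m) x = vars m x.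
Proof.
elim: c m => //= [c1 IH1 c2 IH2|y e|a e g c1 IH1 c2 IH2|e c IH] m.
- by rewrite mem_cat negb_or => /andP[x1 x2]; rewrite IH2 ?IH1.
- by rewrite inE => /negbTE ->.
- by rewrite mem_cat negb_or => /andP[x1 x2]; case: eqP => _; [apply: IH1|apply: IH2].
- by move=> xc; elim: (eval _ _ _) => //= k IHk; rewrite IH.
Qed.

(** The bound [k <= N] keeps the saturating increment of the counter exact. *)
Lemma exec_for (I : nat -> memory -> Prop) x e c m k :
  eval N (vars (set_var m x 0)) e = k -> k <= N ->
  x \notin assigned c ->
  I 0 (set_var m x 0) ->
  (forall i m', i < k -> vars m' x = i -> I i m' ->
     I i.+1 (set_var (exec c m') x i.+1)) ->
  I k (exec (CFor x e c) m).
Proof.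
move=> ke kN xc I0 Istep.
rewrite /CFor [exec _ _]/= min0n ke.
suff H i : i <= k -> let m' := iter i (fun m =>
      set_var (exec c m) x (minn (vars (exec c m) x + 1) N)) (set_var m x 0) in
    I i m' /\ vars m' x = i by have [] := H k (leqnn k).
elim: i => [|i IH] lei /=; first by rewrite eqxx.
have [Ii xi] := IH (ltnW lei).
rewrite vars_exec // xi eqxx.
have -> : minn (i + 1) N = i.+1 by lia.
by split=> //; apply: Istep.
Qed.

Fixpoint CIfAll (l : seq (nat * expr * bool)) (c1 c2 : cmd) : cmd :=
  if l is (a, e, b) :: l' then
    if b then CIf a e (cell1 S) (CIfAll l' c1 c2) c2
    else CIf a e (cell1 S) c2 (CIfAll l' c1 c2)
  else c1.

Definition holds (m : memory) (t : nat * expr * bool) : bool :=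
  (arrs m t.1.1 (eval N (vars m) t.1.2) == cell1 S) == t.2.

Lemma exec_ifall l c1 c2 m :
  exec (CIfAll l c1 c2) m = if all (holds m) l then exec c1 m else exec c2 m.
Proof.
elim: l => //= -[[a e] []] l IH /=; rewrite /holds /= -/(holds m) IH;
  by case: (arrs m a _ == _).
Qed.

Definition nest (xs : seq nat) (c : cmd) : cmd :=
  foldr (fun x => CFor x ESize) c xs.

(** * Iterating a guarded rule to a fixed point *)

Section Saturation.
Variables (c : cmd) (Inv : arrays -> Prop) (mu : arrays -> nat).
Hypothesis pure_c : assigned c = [::].

Lemma assigned_nest xs y : (y \in assigned (nest xs c)) = (y \in xs).
Proof.
elim: xs => [|x xs IH] /=; first by rewrite pure_c.
by rewrite inE mem_cat -/(nest xs c) IH inE orbCA orbb orbC.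
Qed.

Definition fires_at (G : seq nat -> arrays -> bool) (k : nat) (A : arrays) (t : seq nat) :=
  [&& size t == k, all (ltn^~ N) t & G t A].

(** A pass in which nothing fires has tested all tuples on the same arrays and so certifies a fixed
    point. Otherwise the first firing met the initial arrays; recording its tuple shows that a fixed
    point is never left. *)
Lemma nest_pass xs (G : seq nat -> arrays -> bool) m : uniq xs ->
  (forall m', (forall y, y \notin xs -> vars m' y = vars m y) ->
     let t := map (vars m') xs in
     all (ltn^~ N) t -> Inv (arrs m') ->
     if G t (arrs m') then Inv (arrs (exec c m')) /\ mu (arrs (exec c m')) < mu (arrs m')
     else arrs (exec c m') = arrs m') ->
  Inv (arrs m) ->
  let m' := exec (nest xs c) m in
  Inv (arrs m') /\
  ((arrs m' = arrs m /\ forall t, ~~ fires_at G (size xs) (arrs m) t) \/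
   (mu (arrs m') < mu (arrs m) /\ exists t, fires_at G (size xs) (arrs m) t)).
Proof.
elim: xs G m => [|x xs IH] G m.
  move=> _ /(_ m (fun _ _ => erefl)) /= /(_ isT) H Im; move: (H Im); case: ifP => GE.
    by move=> [Im' lt]; split=> //; right; split=> //; exists [::]; rewrite /fires_at GE.
  move=> E; rewrite E; split=> //; left; split=> // -[|//].
  by rewrite /fires_at GE.
rewrite [uniq _]/= => /andP[xxs uxs] body Im.
pose J i (m' : memory) := [/\ Inv (arrs m'),
  forall y, y \notin x :: xs -> vars m' y = vars m y &
  (arrs m' = arrs m /\ forall j t, j < i -> ~~ fires_at G (size xs).+1 (arrs m) (j :: t)) \/
  (mu (arrs m') < mu (arrs m) /\ exists t, fires_at G (size xs).+1 (arrs m) t)].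
have : J N (exec (CFor x ESize (nest xs c)) m).
  apply: exec_for => //=.
  - by rewrite assigned_nest.
  - split=> // [y|]; first by rewrite inE negb_or => /andP[/negbTE yx _] /=; rewrite yx.
    by left.
  move=> i m' li xi [Im' vE cases].
  have [|Ires cases'] := IH (fun t => G (i :: t)) m' uxs _ Im'.
  - move=> m'' vE'' t tN Im''; have xE : vars m'' x = i by rewrite vE''.
    have /= := body m''; rewrite xE; apply=> //.
      by move=> y; rewrite inE negb_or => /andP[yx yxs]; rewrite vE'' // vE // inE negb_or yx.
    by rewrite li.
  split=> //=.
    move=> y yn; have := yn; rewrite inE negb_or => /andP[/negbTE yx yxs].
    by rewrite yx vars_exec ?assigned_nest // vE.
  have fE A t : fires_at G (size xs).+1 A (i :: t) = fires_at (fun t => G (i :: t)) (size xs) A t.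
    by rewrite /fires_at /= eqSS li.
  case: cases => [[AE none]|[lt ex]]; case: cases' => [[AE' none']|[lt' [t ex']]].
  - left; rewrite AE' AE; split=> // j t; rewrite ltnS leq_eqVlt => /predU1P[->|]; last exact: none.
    by rewrite fE -AE.
  - by right; rewrite -AE; split=> //; exists (i :: t); rewrite fE.
  - by right; rewrite AE'.
  - by right; split=> //; apply: ltn_trans lt.
move=> [Ires _ cases] /=; split=> //; case: cases => [[AE none]|]; [left|by right].
split=> // -[|j t]; first by rewrite /fires_at.
by case: (ltnP j N) => lj; [apply: none|rewrite /fires_at /= [j < N]ltnNge lj /= andbF].
Qed.

(** Every pass that changes the arrays lowers [mu], so with more passes than the initial potential
    one of them is idle. *)
Lemma repeat_saturates xs (G : seq nat -> arrays -> bool) e m : uniq xs ->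
  (forall m', (forall y, y \notin xs -> vars m' y = vars m y) ->
     let t := map (vars m') xs in
     all (ltn^~ N) t -> Inv (arrs m') ->
     if G t (arrs m') then Inv (arrs (exec c m')) /\ mu (arrs (exec c m')) < mu (arrs m')
     else arrs (exec c m') = arrs m') ->
  Inv (arrs m) -> mu (arrs m) < eval N (vars m) e ->
  let m' := exec (CRepeat e (nest xs c)) m in
  Inv (arrs m') /\ forall t, ~~ fires_at G (size xs) (arrs m') t.
Proof.
move=> uxs body Im; rewrite /=; set k := eval _ _ _ => muk.
suff H i : let m' := iter i (exec (nest xs c)) m in
    [/\ Inv (arrs m'), forall y, y \notin xs -> vars m' y = vars m y &
     (forall t, ~~ fires_at G (size xs) (arrs m') t) \/ mu (arrs m') + i <= mu (arrs m)].
  by have [I1 _ [none|le]] := H k; split=> //; move: le muk; lia.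
elim: i => [|i [Ii vE cases]] /=; first by split=> //; right; rewrite addn0.
set mi := iter i _ m in Ii vE cases *.
have [|Ires cases'] := @nest_pass xs G mi uxs _ Ii.
  by move=> m' vE' t; apply: body => y yn; rewrite vE' ?vE.
split=> //; first by move=> y yn; rewrite vars_exec ?assigned_nest ?vE.
case: cases' => [[-> none]|[lt [t ex]]]; first by left.
case: cases => [none|le]; first by move: (none t); rewrite ex.
by right; lia.
Qed.
End Saturation.

Lemma exec_skip m : exec (CSkip S) m = m. Proof. by []. Qed.
Lemma exec_seq c1 c2 m : exec (CSeq c1 c2) m = exec c2 (exec c1 m). Proof. by []. Qed.
Lemma exec_set x e m : exec (CSet S x e) m = set_var m x (minn (eval N (vars m) e) N).
Proof. by []. Qed.
Lemma exec_write a e g m : exec (CWrite a e g) m = set_arr m a (eval N (vars m) e) g.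
Proof. by []. Qed.
Lemma exec_if a e g c1 c2 m : exec (CIf a e g c1 c2) m =
  if arrs m a (eval N (vars m) e) == g then exec c1 m else exec c2 m.
Proof. by []. Qed.
Definition execE := (exec_skip, exec_seq, exec_set, exec_write, exec_if).
End Macros.
Arguments exec : simpl never.

(** * Computing the ordering *)

Section OrderStage.
Variables (S : finType) (N : nat).
Notation arrays := (nat -> nat -> cell S).
Notation exec := (@exec S N).

Lemma eq_ix p q y y' : y < N -> y' < N ->
  (p * N + y == q * N + y') = (p == q) && (y == y').
Proof.
move=> ly ly'; apply/eqP/andP => [E|[/eqP-> /eqP->]] //.
have N0 : 0 < N by lia.
have E1 : p = q by move: (congr1 (divn^~ N) E); rewrite !divnMDl // !divn_small // !addn0.
by split; apply/eqP => //; move: E; rewrite E1; lia.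
Qed.

Definition bit (A : arrays) (a p y : nat) : bool := A a (p * N + y) == cell1 S.

Lemma bit_set (m : memory S) a b p q y y' g : y < N -> y' < N ->
  bit (arrs (set_arr m a (p * N + y) g)) b q y' =
  if [&& b == a, q == p & y' == y] then g == cell1 S else bit (arrs m) b q y'.
Proof.
by move=> ly ly'; rewrite /bit /= eq_ix //; case: ifP.
Qed.

Definition eix (e1 e2 : expr) : expr := EAdd (EMul e1 ESize) e2.

(* Array 1 holds the order relation, row [j + 2] of array 2 the [j]-th set. *)
Definition ord_bit (x y : nat) (b : bool) := (1, eix (EVar x) (EVar y), b).
(** The offset 2 skips the header and the target, which are read as lists 0 and 1. *)
Definition set_bit (j x : nat) (b : bool) :=
  (2, eix (EAdd (EVar j) (EConst 2)) (EVar x), b).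
Definition write_ord (x y : nat) : cmd S :=
  CWrite 1 (eix (EVar x) (EVar y)) (cell1 S).

Definition vA := 5. Definition vB := 6. Definition vX := 7.
Definition vY := 8. Definition vZ := 9. Definition vJ := 10.

(** Transitivity and the two forcing rules. The last test of each asks that the conclusion be
    absent, so that every firing adds a pair. *)
Definition closure_rule : cmd S :=
  CIfAll [:: ord_bit vX vY true; ord_bit vY vZ true; ord_bit vX vZ false]
    (write_ord vX vZ)
 (CIfAll [:: set_bit vJ vX true; set_bit vJ vZ true; set_bit vJ vY false;
             ord_bit vX vY true; ord_bit vZ vY false]
    (write_ord vZ vY)
 (CIfAll [:: set_bit vJ vX true; set_bit vJ vZ true; set_bit vJ vY false;
             ord_bit vY vX true; ord_bit vY vZ false]
    (write_ord vY vZ)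
    (CSkip S))).

Definition close_order : cmd S :=
  CRepeat (EAdd (EMul ESize ESize) (EConst 1)) (nest [:: vX; vY; vZ; vJ] closure_rule).

(** All of ['I_N] is ordered, so [n] need not be kept; the surplus elements belong to no set and can
    be placed last in a consecutive ordering. *)
Definition order_stage : cmd S :=
  CFor vA ESize (CFor vB (EVar vA)
    (CIfAll [:: ord_bit vA vB false; ord_bit vB vA false]
       (CSeq (write_ord vA vB) close_order) (CSkip S))).

Definition ordr (A : arrays) (x y : 'I_N) : bool := bit A 1 x y.
Definition setr (A : arrays) (j : 'I_N) (x : 'I_N) : bool := bit A 2 (j + 2) x.

Definition g_trans (A : arrays) x y z :=
  [&& bit A 1 x y, bit A 1 y z & ~~ bit A 1 x z].
Definition g_left (A : arrays) x y z j :=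
  [&& bit A 2 (j + 2) x, bit A 2 (j + 2) z, ~~ bit A 2 (j + 2) y,
      bit A 1 x y & ~~ bit A 1 z y].
Definition g_right (A : arrays) x y z j :=
  [&& bit A 2 (j + 2) x, bit A 2 (j + 2) z, ~~ bit A 2 (j + 2) y,
      bit A 1 y x & ~~ bit A 1 y z].

Definition closure_guard (t : seq nat) (A : arrays) : bool :=
  if t is [:: x; y; z; j] then
    [|| g_trans A x y z, g_left A x y z j | g_right A x y z j]
  else false.

Definition same_but (a : nat) (A B : arrays) := forall b i, b != a -> A b i = B b i.

Lemma setr_same A B : same_but 1 A B -> setr A =2 setr B.
Proof. by move=> H j x; rewrite /setr /bit H. Qed.

Definition missing (A : arrays) : nat := #|[set p : 'I_N * 'I_N | ~~ ordr A p.1 p.2]|.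

Lemma write_ord_missing m (x y : 'I_N) : ~~ ordr (arrs m) x y ->
  let m' := set_arr m 1 (x * N + y) (cell1 S) in missing (arrs m') < missing (arrs m).
Proof.
move=> nxy /=; apply/proper_card/properP; split.
  apply/subsetP => -[u v]; rewrite !inE /ordr bit_set //=.
  by case: ifP; rewrite ?eqxx.
by exists (x, y); rewrite !inE /ordr //= bit_set // !eqxx.
Qed.

(** * Closing an order inside a given closed relation *)

Section Close.
Variables (A0 : arrays) (R : 'I_N -> 'I_N -> Prop).
Hypothesis R_trans : forall x y z, R x y -> R y z -> R x z.
Hypothesis R_forcing : forcing_closed (setr A0) R.

(** The computed order is only kept between the initial one and a closed relation [R]. With [R] the
    abstract extension this yields irreflexivity, while closedness comes from saturation. *)
Definition close_inv (A : arrays) : Prop :=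
  [/\ same_but 1 A A0, forall x y, ordr A0 x y -> ordr A x y &
      forall x y, ordr A x y -> R x y].

Lemma write_ord_inv m (x y : 'I_N) : close_inv (arrs m) -> R x y ->
  close_inv (arrs (set_arr m 1 (x * N + y) (cell1 S))).
Proof.
move=> [sb lo hi] Rxy; split=> [b i /negbTE nb|u v /lo|u v].
- by rewrite /= nb /= sb ?nb.
- by rewrite /ordr bit_set //; case: ifP.
- rewrite /ordr bit_set //; case: ifP => [/and3P[_ /eqP E1 /eqP E2] _|_]; last exact: hi.
  by rewrite (val_inj E1) (val_inj E2).
Qed.

Lemma closure_rule_spec m' t : t = map (vars m') [:: vX; vY; vZ; vJ] ->
  all (ltn^~ N) t -> close_inv (arrs m') ->
  if closure_guard t (arrs m')
  then close_inv (arrs (exec closure_rule m')) /\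
       missing (arrs (exec closure_rule m')) < missing (arrs m')
  else arrs (exec closure_rule m') = arrs m'.
Proof.
move=> ->; rewrite [all _ _]/= => /and5P[lx ly lz lj _] inv.
rewrite /closure_rule !exec_ifall !execE /= /holds /= -!/(bit (arrs m') _ _ _) !eqb_id !eqbF_neg !andbT.
rewrite -/(g_trans _ _ _ _) -/(g_left _ _ _ _ _) -/(g_right _ _ _ _ _).
pose x := Ordinal lx; pose y := Ordinal ly; pose z := Ordinal lz; pose j := Ordinal lj.
have [sb lo hi] := inv.
have sE := setr_same sb.
have write u v : R u v -> ~~ ordr (arrs m') u v ->
    close_inv (arrs (set_arr m' 1 (u * N + v) (cell1 S))) /\
    missing (arrs (set_arr m' 1 (u * N + v) (cell1 S))) < missing (arrs m').
  by move=> Ruv nuv; split; [apply: write_ord_inv|apply: write_ord_missing].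
case: (boolP (g_trans _ _ _ _)) => [/and3P[xy yz nxz]|_] /=.
  by apply: (write x z) => //; apply: R_trans (hi x y xy) (hi y z yz).
case: (boolP (g_left _ _ _ _ _)) => [/and5P[xj zj yj xy nzy]|_] /=.
  apply: (write z y) => //.
  have [|||c1 _] := @R_forcing j x y z; rewrite -?sE //; apply: c1; exact: (hi x y xy).
case: (boolP (g_right _ _ _ _ _)) => [/and5P[xj zj yj yx nyz]|_] //=.
apply: (write y z) => //.
have [|||_ c2] := @R_forcing j x y z; rewrite -?sE //; apply: c2; exact: (hi y x yx).
Qed.

Lemma close_order_spec m : close_inv (arrs m) ->
  let A := arrs (exec close_order m) in
  [/\ close_inv A, transitive (ordr A) & forcing_closed (setr A0) (ordr A)].
Proof.
move=> inv /=.
have [||inv' none] := @repeat_saturates S N closure_rule close_inv missing erefl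
    [:: vX; vY; vZ; vJ] closure_guard (EAdd (EMul ESize ESize) (EConst 1)) m erefl _ inv.
- by move=> m' _ t; apply: closure_rule_spec.
- rewrite /= addn1 ltnS; apply: leq_trans (max_card _) _.
  by rewrite card_prod card_ord.
rewrite -/close_order in inv' none *; set A := arrs _ in inv' none *.
have no (x y z j : 'I_N) : ~~ closure_guard [:: val x; val y; val z; val j] A.
  by have := none [:: val x; val y; val z; val j]; rewrite /fires_at [all _ _]/= !ltn_ord.
have [sb lo hi] := inv'; have sE := setr_same sb.
split=> // [y x z xy yz|j x y z xj zj yj].
  (* The fourth index is a filler, as the transitivity guard mentions no set. *)
  apply/negPn/negP => nxz; have := no x y z x.
  by rewrite /closure_guard /g_trans -!/(ordr A _ _) xy yz nxz.
have := no x y z j.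
rewrite /closure_guard /g_left /g_right -!/(ordr A _ _) -!/(setr A _ _) !sE xj zj yj /=.
by rewrite !negb_or !negb_and !negbK => /and3P[_ /orP h1 /orP h2];
  split=> [xy|yx]; [case: h1|case: h2] => //; rewrite ?xy ?yx.
Qed.
End Close.

Definition good_order (A0 A : arrays) : Prop :=
  [/\ same_but 1 A A0, irreflexive (ordr A), transitive (ordr A) &
      forcing_closed (setr A0) (ordr A)].

Lemma order_stage_spec m (k : 'I_N -> nat) :
  injective k -> forcing_closed (setr (arrs m)) (fun x y => k x < k y) ->
  (forall i, arrs m 1 i = cell0 S) ->
  let A := arrs (exec order_stage m) in
  good_order (arrs m) A /\ forall x y, x != y -> ordr A x y || ordr A y x.
Proof.
move=> k_inj k_cl D0; set A0 := arrs m.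
pose good (m' : memory S) := good_order A0 (arrs m').
pose comp (m' : memory S) (x y : 'I_N) := ordr (arrs m') x y || ordr (arrs m') y x.
have stepE m' : exec (CIfAll [:: ord_bit vA vB false; ord_bit vB vA false]
       (CSeq (write_ord vA vB) close_order) (CSkip S)) m' =
    if ~~ bit (arrs m') 1 (vars m' vA) (vars m' vB) &&
       ~~ bit (arrs m') 1 (vars m' vB) (vars m' vA)
    then exec close_order (set_arr m' 1 (vars m' vA * N + vars m' vB) (cell1 S)) else m'.
  by rewrite exec_ifall [all _ _]/= /holds !eqbF_neg andbT.
have pair m' (a b : 'I_N) : vars m' vA = a -> vars m' vB = b -> b < a -> good m' ->
    let m'' := exec (CIfAll [:: ord_bit vA vB false; ord_bit vB vA false]
       (CSeq (write_ord vA vB) close_order) (CSkip S)) m' in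
    [/\ good m'', comp m'' a b & forall x y, comp m' x y -> comp m'' x y].
  move=> aE bE ba gm m''; rewrite {}/m'' stepE aE bE -!/(ordr _ _ _).
  case: (boolP (ordr (arrs m') a b)) => [ab|nab]; first by split=> //; rewrite /comp ab.
  case: (boolP (ordr (arrs m') b a)) => [ab|nba]; first by split=> //; rewrite /comp ab orbT.
  rewrite [_ && _]/=.
  have [sb irr tr cl] := gm.
  have anb : a <> b by move=> E; rewrite E ltnn in ba.
  have asym := forced_asym_key k_inj anb k_cl.
  pose D x y : Prop := ordr (arrs m') x y.
  pose R := extension (setr A0) D a b.
  have D_irr x : ~ D x x by rewrite /D irr.
  have D_tr x y z : D x y -> D y z -> D x z by apply: tr.
  have R_tr x y z : R x y -> R y z -> R x z by apply: extension_trans.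
  have R_cl : forcing_closed (setr A0) R by apply: extension_forcing.
  have R_irr x : ~ R x x by apply: (extension_irr D_irr D_tr cl (negP nab) (negP nba) asym).
  set m1 := set_arr m' 1 (a * N + b) (cell1 S).
  (* The lower bound is the order with the new pair already written, so that closing is known to
     keep that pair. *)
  have inv1 : close_inv (arrs m1) R (arrs m1).
    split=> // x y; rewrite /ordr bit_set //; case: ifP => [/and3P[_ /eqP E1 /eqP E2] _|_].
      by rewrite (val_inj E1) (val_inj E2); apply: extension_pair.
    exact: extension_sub.
  have sb1 : same_but 1 (arrs m1) A0 by move=> c i /negbTE nc; rewrite /= nc /= sb ?nc.
  have R_cl1 : forcing_closed (setr (arrs m1)) R.
    by move=> j x y z; rewrite !(setr_same sb1); apply: R_cl.
  have [[sb2 lo hi] tr2 cl2] := close_order_spec R_tr R_cl1 inv1.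
  rewrite -/m1; split.
  - split=> //.
    + by move=> c i nc; rewrite sb2 ?sb1.
    + by move=> x; apply/negP => /hi/R_irr.
    + by move=> j x y z xj zj yj; apply: (cl2 j x y z); rewrite ?(setr_same sb1).
  - rewrite /comp lo // /ordr bit_set // !eqxx //=.
  - have up x y : ordr (arrs m') x y -> ordr (arrs (exec close_order m1)) x y.
      by move=> xy; apply: lo; rewrite /ordr bit_set //; case: ifP.
    by move=> x y /orP[/up|/up]; rewrite /comp => ->; rewrite ?orbT.
pose I i (m' : memory S) := good m' /\ forall x y : 'I_N, y < x -> x < i -> comp m' x y.
have : I N (exec order_stage m).
  apply: exec_for => //=.
    split=> //; rewrite /good /good_order /=; split=> //.
    + by move=> x; rewrite /ordr /bit D0.
    + by move=> x y z; rewrite /ordr /bit D0.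
    + by move=> j x y z; rewrite /ordr /bit !D0.
  move=> i m1 li aE [gm1 cm1].
  pose I' l (m' : memory S) := [/\ good m', vars m' vA = i,
    forall x y : 'I_N, y < x -> x < i -> comp m' x y &
    forall x y : 'I_N, val x = i -> y < l -> comp m' x y].
  suff : I' i (exec (CFor vB (EVar vA)
      (CIfAll [:: ord_bit vA vB false; ord_bit vB vA false]
         (CSeq (write_ord vA vB) close_order) (CSkip S))) m1).
    move=> [g2 aE2 c2 c2']; split=> //= x y yx; rewrite ltnS leq_eqVlt => /predU1P[xi|]; last exact: c2.
    by apply: c2' => //; rewrite -xi.
  apply: exec_for => //=; first exact: ltnW.
  move=> l m2 ll bE [g2 aE2 c2 c2'].
  have ll' : l < N by apply: ltn_trans li.
  have [g3 c3 mono] := pair m2 (Ordinal li) (Ordinal ll') aE2 bE ll g2.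
  split=> //=.
  + rewrite vars_exec //.
  + by move=> x y yx xi; apply: mono; apply: c2.
  + move=> x y xi; rewrite ltnS leq_eqVlt => /predU1P[yl|yl]; last by apply: mono; apply: c2'.
    have -> : x = Ordinal li by apply: val_inj.
    by have -> : y = Ordinal ll' by apply: val_inj.
move=> [gN cN]; split=> // x y; rewrite -val_eqE neq_ltn => /orP[xy|yx].
  by have := cN y x xy (ltn_ord _); rewrite /comp orbC.
by have := cN x y yx (ltn_ord _).
Qed.
End OrderStage.

(** * Sorting the permutation *)

Section SortStage.
Variables (S : finType) (N n : nat).
Notation arrays := (nat -> nat -> cell S).
Notation exec := (@exec S N).
Notation bit := (@bit S N).
Hypothesis nN : n < N.

(* Row [N + x] of array 3 holds the image of [x] under the current permutation,
   in one-hot form; the elements of ['I_n] are stored as [1, ..., n]. *)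
Definition perm_bit (x y : nat) (b : bool) :=
  (3, eix (EAdd ESize (EVar x)) (EVar y), b).
Definition write_perm (x y : nat) (b : bool) : cmd S :=
  CWrite 3 (eix (EAdd ESize (EVar x)) (EVar y)) (if b then cell1 S else cell0 S).

Definition swap_rule : cmd S :=
  CIfAll [:: set_bit vJ vA true; set_bit vJ vB true; ord_bit vA vB true;
             perm_bit vA vX true; perm_bit vB vY true; ord_bit vY vX true]
    (CSeq (write_perm vA vX false) (CSeq (write_perm vB vY false)
    (CSeq (write_perm vA vY true) (write_perm vB vX true))))
    (CSkip S).

Definition sort_stage : cmd S :=
  CFor vJ ESize
    (CRepeat (EAdd (EMul ESize (EMul ESize ESize)) (EConst 1))
       (nest [:: vA; vB; vX; vY] swap_rule)).

(** The last test lets the rule fire at most once, as the strictly decreasing potential requires. *)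
Definition verdict_rule : cmd S :=
  CIfAll [:: perm_bit vA vX true; perm_bit vA vA false; (4, EConst 0, false)]
    (CWrite 4 (EConst 0) (cell1 S)) (CSkip S).

Definition verdict_stage : cmd S := nest [:: vA; vX] verdict_rule.

(** The second clause is there because the loops also visit row numbers outside 1 to [n]. *)
Definition represents (A : arrays) (rho : 'S_n) : Prop :=
  (forall (i : 'I_n) y, y < N -> bit A 3 (N + i.+1) y = (y == (rho i).+1)) /\
  (forall x y, x < N -> y < N -> (x == 0) || (n < x) -> bit A 3 (N + x) y = false).

Lemma elt_cases x : ((x == 0) || (n < x)) \/ exists i : 'I_n, x = i.+1.
Proof.
case: x => [|x]; first by left.
case: (ltnP n x.+1) => lt; first by left.
by right; exists (Ordinal lt).
Qed.

Lemma eltN (i : 'I_n) : i.+1 < N. Proof. by have := ltn_ord i; lia. Qed.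

Lemma represents_swap m rho (i k : 'I_n) : represents (arrs m) rho -> i != k ->
  let m1 := set_arr m 3 ((N + i.+1) * N + (rho i).+1) (cell0 S) in
  let m2 := set_arr m1 3 ((N + k.+1) * N + (rho k).+1) (cell0 S) in
  let m3 := set_arr m2 3 ((N + i.+1) * N + (rho k).+1) (cell1 S) in
  let m4 := set_arr m3 3 ((N + k.+1) * N + (rho i).+1) (cell1 S) in
  represents (arrs m4) (tperm i k * rho)%g.
Proof.
move=> [H1 H2] ik m1 m2 m3 m4.
have E x y : y < N -> bit (arrs m4) 3 (N + x) y =
    if (x == k.+1) && (y == (rho i).+1) then true else
    if (x == i.+1) && (y == (rho k).+1) then true else
    if (x == k.+1) && (y == (rho k).+1) then false else
    if (x == i.+1) && (y == (rho i).+1) then false else bit (arrs m) 3 (N + x) y.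
  by move=> ly; rewrite !bit_set ?eltN //= !eqn_add2l eqxx.
have ne : (rho i == rho k) = false by rewrite (inj_eq perm_inj); apply/negbTE.
split=> [p y ly|x y lx ly out]; rewrite E //.
  rewrite permM !eqSS !val_eqE; case: tpermP => [->|->|/eqP pi /eqP pk].
  - rewrite eqxx (negbTE ik) /= H1 //; case: (y =P (rho k).+1) => // _.
    by case: eqP.
  - rewrite eqxx (eq_sym k) (negbTE ik) /= H1 //; case: (y =P (rho i).+1) => // _.
    by case: eqP.
  - by rewrite (negbTE pi) (negbTE pk) /= H1.
have nx (q : 'I_n) : (x == q.+1) = false by have := ltn_ord q; lia.
by rewrite !nx /= H2.
Qed.

(** * Sorting inside each set in turn *)

Section Correctness.
Variables (A0 : arrays) (Xs : seq {set 'I_n}).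
Hypothesis set_in : forall j (i : 'I_n), bit A0 2 (j + 2) i.+1 = (i \in nth set0 Xs j).
Hypothesis set_out : forall j x, x < N -> (x == 0) || (n < x) -> bit A0 2 (j + 2) x = false.

Definition lt_elt (i k : 'I_n) : bool := bit A0 1 i.+1 k.+1.
Hypotheses (lt_irr : irreflexive lt_elt) (lt_tr : transitive lt_elt)
  (lt_tot : forall x y, x != y -> lt_elt x y || lt_elt y x)
  (Xs_int : forall B, B \in Xs -> interval lt_elt B).

(** The potential in [repeat_saturates] is a function of the arrays, so the permutation has to be
    recovered from them; 1 is returned when none can be read off. *)
Definition perm_of (A : arrays) : 'S_n :=
  odflt 1%g [pick rho : 'S_n | [forall i : 'I_n, forall k : 'I_n,
     bit A 3 (N + i.+1) k.+1 == (rho i == k)]].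

Lemma perm_ofE A rho : represents A rho -> perm_of A = rho.
Proof.
move=> [H _]; rewrite /perm_of; case: pickP => [rho' /forallP H'|/(_ rho)/negP[]].
  apply/permP => i; apply/eqP; have /forallP/(_ (rho i))/eqP := H' i.
  by rewrite H ?eltN // eqxx => <-.
by apply/forallP => i; apply/forallP => k; rewrite H ?eltN // eqSS val_eqE (eq_sym k).
Qed.

Definition unsortedness (A : arrays) : nat :=
  n * (n * n) - sortedness lt_elt (perm_of A).

(** [P] is the answer for the original target and [j] the number of sets already dropped. *)
Definition sort_inv (P : Prop) (j : nat) (A : arrays) : Prop :=
  same_but 3 A A0 /\
  exists rho, represents A rho /\ (sym_product (drop j Xs) rho <-> P).

Definition swap_guard (j : nat) (t : seq nat) (A : arrays) : bool :=
  if t is [:: a; b; x; y] then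
    [&& bit A 2 (j + 2) a, bit A 2 (j + 2) b, bit A 1 a b, bit A 3 (N + a) x,
        bit A 3 (N + b) y & bit A 1 y x]
  else false.

Lemma bit_same A a p y : same_but 3 A A0 -> a != 3 -> bit A a p y = bit A0 a p y.
Proof. by move=> H ne; congr (_ == _); apply: H. Qed.

Lemma swap_rule_spec P j m : vars m vJ = j ->
  let t := map (vars m) [:: vA; vB; vX; vY] in
  all (ltn^~ N) t -> sort_inv P j (arrs m) ->
  if swap_guard j t (arrs m)
  then sort_inv P j (arrs (exec swap_rule m)) /\
       unsortedness (arrs (exec swap_rule m)) < unsortedness (arrs m)
  else arrs (exec swap_rule m) = arrs m.
Proof.
move=> jE t; rewrite {}/t [all _ _]/= => /and5P[la lb lx ly _] [sb [rho [rep PE]]].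
rewrite /swap_rule exec_ifall; set l := (X in all _ X).
have gE : all (holds N m) l = swap_guard j (map (vars m) [:: vA; vB; vX; vY]) (arrs m).
  by rewrite /= /holds /= -!/(bit (arrs m) _ _ _) !eqb_id !andbT jE.
rewrite !execE; case: ifP => g; last first.
  by have -> : all (holds N m) l = false by rewrite gE; exact: g.
have -> : all (holds N m) l = true by rewrite gE; exact: g.
case/and5P: g => ja jb ab ax /andP[hby yx] {l gE}; rewrite /=.
move: (vars m vA) (vars m vB) (vars m vX) (vars m vY) la lb lx ly ja jb ab ax hby yx
  => a b x y la lb lx ly.
have b1 p q := bit_same p q sb (isT : 1 != 3); have b2 p q := bit_same p q sb (isT : 2 != 3).
rewrite !b1 !b2.
have [oa|[i ->]] := elt_cases a; first by rewrite set_out.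
have [ob|[k ->]] := elt_cases b; first by move=> _; rewrite set_out.
rewrite !set_in => iX kX ik.
case: (rep) => H1 H2; rewrite !H1 // => /eqP-> /eqP->.
rewrite -/(lt_elt _ _) in ik * => rki.
have ne : i != k by apply/eqP=> E; rewrite E lt_irr in ik.
have rep' := represents_swap rep ne.
split.
  split=> [c i0 /negbTE nc|]; first by rewrite /= !nc /= sb ?nc.
  exists (tperm i k * rho)%g; split=> //.
  rewrite -PE; case: (ltnP j (size Xs)) => lj; last by rewrite nth_default // inE in iX.
  by rewrite (drop_nth set0 lj); apply: sym_product_tperm.
rewrite /unsortedness (perm_ofE rep') (perm_ofE rep).
have := sortedness_swap lt_irr lt_tr ik rki.
have := sortedness_bound lt_elt (tperm i k * rho)%g; rewrite card_ord.
move: (sortedness _ _) (sortedness _ _) => u v; lia.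
Qed.

Lemma sort_stage_spec m rho : arrs m = A0 -> size Xs <= N -> represents A0 rho ->
  let A := arrs (exec sort_stage m) in
  exists rho', [/\ same_but 3 A A0, represents A rho' & rho' = 1%g <-> sym_product Xs rho].
Proof.
move=> mE szX rep A; rewrite {}/A.
pose P := sym_product Xs rho.
have : sort_inv P N (arrs (exec sort_stage m)).
  apply: (@exec_for S N (fun j m' => sort_inv P j (arrs m'))) => //=.
    by rewrite mE; split=> //; exists rho; split=> //; rewrite drop0.
  move=> j m' lj jE inv.
  have [||[sb [rho' [rep' PE]]] none] := @repeat_saturates S N swap_rule (sort_inv P j)
    unsortedness erefl [:: vA; vB; vX; vY] (swap_guard j)
    (EAdd (EMul ESize (EMul ESize ESize)) (EConst 1)) m' erefl _ inv.
  - by move=> m'' vE; apply: swap_rule_spec; rewrite vE.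
  - by rewrite /= addn1 ltnS /unsortedness (leq_trans (leq_subr _ _)) // !leq_mul // ltnW.
  set A := arrs _ in sb rep' none *.
  split=> //; exists rho'; split=> //; rewrite -PE.
  (* The loop makes [N] rounds whatever the number of sets; once the sets are exhausted, [drop]
     gives the empty list before and after. *)
  case: (ltnP j (size Xs)) => ljX; last by rewrite !drop_oversize // ltnW.
  rewrite (drop_nth set0 ljX); apply: iff_sym; apply: sym_product_sorted => //.
    by move=> B /mem_drop; apply: Xs_int.
  move=> i k iX kX ik; apply/negP => rki.
  (* An inversion left inside the set would be a tuple at which the swap rule still fires. *)
  have := none [:: i.+1; k.+1; (rho' i).+1; (rho' k).+1].
  have b1 p q := bit_same p q sb (isT : 1 != 3); have b2 p q := bit_same p q sb (isT : 2 != 3).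
  rewrite /fires_at [all _ _]/= !eltN /= !b1 !b2 !set_in iX kX.
  case: rep' => H1 _; rewrite !H1 ?eltN // !eqxx.
  by rewrite -!/(lt_elt _ _) ik rki.
move=> [sb [rho' [rep' PE]]]; exists rho'; split=> //.
by move: PE; rewrite drop_oversize.
Qed.
End Correctness.

Lemma verdict_stage_spec m rho : represents (arrs m) rho -> arrs m 4 0 = cell0 S ->
  arrs (exec verdict_stage m) 4 0 != cell1 S <-> rho = 1%g.
Proof.
move=> rep R0; case: (rep) => H1 H2.
pose G (t : seq nat) (A : arrays) := if t is [:: a; x] then
  [&& bit A 3 (N + a) x, ~~ bit A 3 (N + a) a & A 4 0 != cell1 S] else false.
pose mu (A : arrays) : nat := A 4 0 != cell1 S.
have [|//|_ cases] := @nest_pass S N verdict_rule (fun=> True) mu erefl [:: vA; vX] G m erefl.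
  move=> m' _ t; rewrite {}/t [all _ _]/= => /and3P[la lx _] _.
  rewrite /verdict_rule exec_ifall !execE; set l := (X in all _ X).
  have gE : all (holds N m') l = G (map (vars m') [:: vA; vX]) (arrs m').
    by rewrite /= /holds /= -!/(bit (arrs m') _ _ _) eqb_id !eqbF_neg andbT.
  case: ifP => g; last by have -> : all (holds N m') l = false by rewrite gE; exact: g.
  have -> : all (holds N m') l = true by rewrite gE; exact: g.
  by split=> //; case/and3P: g => _ _ nR; rewrite /mu /= nR.
rewrite -/verdict_stage in cases.
case: cases => [[-> none]|[lt [t]]].
  rewrite R0; split=> // _; apply/permP => i; rewrite perm1; apply/eqP.
  have := none [:: i.+1; (rho i).+1].
  rewrite /fires_at [all _ _]/= !eltN /= !H1 ?eltN // eqxx R0 /= andbT negbK.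
  by rewrite eqSS val_eqE eq_sym.
move=> fires; split.
  by move: lt; rewrite /mu R0; case: (_ != _).
move=> E; exfalso; move: fires; rewrite /fires_at.
case: t => [|a [|x []]] //= /and3P[/and3P[la lx _] ax]; rewrite R0 => /andP[na _].
move: ax na; have [oa|[i ->]] := elt_cases a; first by rewrite H2.
by rewrite !H1 ?eltN // E perm1 eqxx.
Qed.
End SortStage.

(** * Parsing the input *)

Definition vI := 0. Definition vL := 1. Definition vK := 2.
Definition vV := 3. Definition vW := 4.

(** All lists are read alike: value v at position k of list l marks column v of row l in array 2 and
    of row l * N + k in array 3. So array 2 holds the sets, and the rows N + k of array 3 the target
    in one-hot form. Positions count from 1. *)
Definition parse_symbol : cmd symbol :=
  CIf 0 (EVar vI) (inl (digit true))
    (CSeq (CSet _ vV (EAdd (EVar vV) (EVar vW)))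
          (CSet _ vW (EAdd (EVar vW) (EVar vW))))
 (CIf 0 (EVar vI) (inl (digit false))
    (CSet _ vW (EAdd (EVar vW) (EVar vW)))
 (CIf 0 (EVar vI) (inl comma)
    (CSeq (CWrite 2 (eix (EVar vL) (EVar vV)) (cell1 _))
    (CSeq (CWrite 3 (eix (eix (EVar vL) (EVar vK)) (EVar vV)) (cell1 _))
    (CSeq (CSet _ vK (EAdd (EVar vK) (EConst 1)))
    (CSeq (CSet _ vV (EConst 0))
          (CSet _ vW (EConst 1))))))
    (CSeq (CSet _ vL (EAdd (EVar vL) (EConst 1)))
          (CSet _ vK (EConst 1))))).

Definition parse_stage : cmd symbol :=
  CSeq (CSet _ vK (EConst 1))
 (CSeq (CSet _ vW (EConst 1))
       (CFor vI ESize parse_symbol)).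

Section Parsing.
Variable N : nat.
Notation exec := (@exec symbol N).

(* The [pK]-th number of the [pL]-th list is being read; [pV] is the value of
   its digits so far, [pW] the weight of the next one; [pE] lists the numbers
   already read. *)
Record pstate := PState
  { pL : nat; pK : nat; pV : nat; pW : nat; pE : seq (nat * nat * nat) }.

Definition pstep (p : pstate) (s : symbol) : pstate :=
  let: PState l k v w e := p in
  match s with
  | inl true => PState l k (minn (v + w) N) (minn (w + w) N) e
  | inl false => PState l k v (minn (w + w) N) e
  | inr false => PState l (minn (k + 1) N) (minn 0 N) (minn 1 N) ((l, k, v) :: e)
  | inr true => PState (minn (l + 1) N) (minn 1 N) v w e
  end.

Definition ix2 (t : nat * nat * nat) : nat := t.1.1 * N + t.2.
Definition ix3 (t : nat * nat * nat) : nat := (t.1.1 * N + t.1.2) * N + t.2.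

Definition marks (l : seq nat) (i : nat) : cell symbol :=
  if i \in l then cell1 _ else cell0 _.

Definition parse_rep (w : seq symbol) (p : pstate) (m : memory symbol) : Prop :=
  [/\ [/\ vars m vL = pL p, vars m vK = pK p, vars m vV = pV p & vars m vW = pW p],
      forall i, arrs m 0 i = nth (cell0 _) (map inl w) i,
      forall i, arrs m 2 i = marks (map ix2 (pE p)) i,
      forall i, arrs m 3 i = marks (map ix3 (pE p)) i &
      forall a i, a \notin [:: 0; 2; 3] -> arrs m a i = cell0 _].

Lemma parse_symbol_spec w p m : vars m vI < size w -> parse_rep w p m ->
  parse_rep w (pstep p (nth comma w (vars m vI))) (exec parse_symbol m).
Proof.
case: p => l k v c e lt [[/= lE kE vE cE] H0 H2 H3 Ho].
have sE : arrs m 0 (vars m vI) = inl (nth comma w (vars m vI)).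
  by rewrite H0 (nth_map comma).
rewrite /parse_symbol !exec_if /= !sE; case: (nth comma w _) => -[] /=; rewrite ?eqxx.
- by rewrite !execE /=; split=> //=; rewrite vE cE.
- by rewrite !execE /=; split=> //=; rewrite cE.
- by rewrite !execE /=; split=> //=; rewrite lE.
rewrite !execE /= lE kE vE; split=> //=.
- by move=> i; rewrite /= H2 /marks inE; case: eqP.
- by move=> i; rewrite /= H3 /marks inE; case: eqP.
- move=> a i; rewrite !inE !negb_or => /and3P[a0 a2 a3].
  by rewrite (negbTE a2) (negbTE a3) /= Ho // !inE !negb_or a0 a2.
Qed.

Definition pstart : pstate := PState 0 1 0 1 [::].

Lemma parse_stage_spec w : size w = N -> 0 < N ->
  parse_rep w (foldl pstep pstart w) (exec parse_stage (init_mem w)).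
Proof.
move=> wN N0; rewrite /parse_stage !exec_seq !exec_set /=.
have -> : minn 1 N = 1 by lia.
set m0 := set_var _ vW 1.
have : (fun i => parse_rep w (foldl pstep pstart (take i w))) N
    (exec (CFor vI ESize parse_symbol) m0).
  apply: (@exec_for _ N (fun i => parse_rep w (foldl pstep pstart (take i w)))) => //.
    by rewrite take0; split=> //= a i; rewrite inE negb_or => /andP[/negbTE->].
  move=> i m' li iE rep; have lw : vars m' vI < size w by rewrite iE wN.
  have := parse_symbol_spec lw rep.
  rewrite iE (take_nth comma) ?wN // -cats1 foldl_cat /=.
  by case=> H ? ? ? ?; split.
by rewrite /= take_oversize // wN.
Qed.

(** The weight may saturate, but a digit 1 at place i means 2 ^ i <= k <= N, so every weight
    actually added is exact. *)
Lemma binary_digits k i : i <= (trunc_log 2 k).+1 -> forall l c e, k <= N ->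
  0 < N ->
  foldl pstep (PState l c 0 1 e) (map digit (take i (binary k))) =
  PState l c (k %% 2 ^ i) (minn (2 ^ i) N) e.
Proof.
move=> + l c e kN N0; elim: i => [|i IH] li.
  by rewrite take0 /= modn1; congr PState; lia.
rewrite (take_nth false) ?size_mkseq // map_rcons -cats1 foldl_cat IH; last exact: ltnW.
rewrite /= nth_mkseq // .
have E : k %% 2 ^ i.+1 = k %% 2 ^ i + odd (k %/ 2 ^ i) * 2 ^ i.
  have lt : k %% 2 ^ i < 2 ^ i by rewrite ltn_pmod ?expn_gt0.
  have kE : k = (k %/ 2 ^ i)./2 * 2 ^ i.+1 + (k %% 2 ^ i + odd (k %/ 2 ^ i) * 2 ^ i).
    have := divn_eq k (2 ^ i); have := odd_double_half (k %/ 2 ^ i).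
    rewrite expnS -muln2; move: (k %/ 2 ^ i) (k %% 2 ^ i) (2 ^ i) => q r P.
    by case: (odd q) => /= E1 E2; rewrite {1}E2 -{1}E1; lia.
  rewrite {1}kE modnMDl modn_small // expnS.
  by move: lt; case: (odd _); lia.
have W2 : minn (minn (2 ^ i) N + minn (2 ^ i) N) N = minn (2 ^ i.+1) N by rewrite expnS; lia.
have le : k %% 2 ^ i.+1 <= k by apply: leq_mod.
by case: (odd _) E => /= E; rewrite W2; congr PState; lia.
Qed.

Lemma foldl_encode_nat k l c e : k <= N -> 0 < N ->
  foldl pstep (PState l c 0 1 e) (encode_nat k) =
  PState l (minn (c + 1) N) 0 1 ((l, c, k) :: e).
Proof.
move=> kN N0; rewrite /encode_nat -cats1 foldl_cat.
have := @binary_digits k _ (leqnn _) l c e kN N0.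
rewrite take_oversize ?size_mkseq // => -> /=.
by rewrite modn_small ?trunc_log_ltn //; congr PState; lia.
Qed.

Fixpoint numbered (l k : nat) (s : seq nat) : seq (nat * nat * nat) :=
  if s is v :: s' then (l, k, v) :: numbered l k.+1 s' else [::].

Fixpoint entries (l : nat) (ls : seq (seq nat)) : seq (nat * nat * nat) :=
  if ls is s :: ls' then numbered l 1 s ++ entries l.+1 ls' else [::].

Lemma foldl_numbers s l c e : all (leq^~ N) s -> c + size s <= N -> 0 < N ->
  foldl pstep (PState l c 0 1 e) (flatten (map encode_nat s)) =
  PState l (c + size s) 0 1 (catrev (numbered l c s) e).
Proof.
move=> + + N0; elim: s c e => [|v s IH] c e; first by rewrite addn0.
move=> /andP[vN sN]; rewrite [size _]/= => le.
rewrite -[flatten _]/(encode_nat v ++ flatten (map encode_nat s)).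
rewrite foldl_cat foldl_encode_nat //.
have -> : minn (c + 1) N = c.+1 by lia.
by rewrite IH //; [congr PState; lia|lia].
Qed.

Lemma foldl_lists ls l e : all (fun s => all (leq^~ N) s && (size s < N)) ls ->
  l + size ls <= N -> 0 < N ->
  foldl pstep (PState l 1 0 1 e) (flatten (map encode_list ls)) =
  PState (l + size ls) 1 0 1 (catrev (entries l ls) e).
Proof.
move=> + + N0; elim: ls l e => [|s ls IH] l e; first by rewrite addn0.
move=> /andP[/andP[sN sz] lsN]; rewrite [size _]/= => le.
rewrite -[flatten _]/(encode_list s ++ flatten (map encode_list ls)).
rewrite foldl_cat /encode_list -cats1 foldl_cat foldl_numbers //.
have -> : foldl pstep (PState l (1 + size s) 0 1 (catrev (numbered l 1 s) e)) [:: semicolon]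
   = PState l.+1 1 0 1 (catrev (numbered l 1 s) e) by rewrite /=; congr PState; lia.
by rewrite IH //; [rewrite catrev_catl; congr PState; lia|lia].
Qed.

Lemma mem_numbered l' k v l c s : ((l', k, v) \in numbered l c s) =
  [&& l' == l, c <= k < c + size s & nth 0 s (k - c) == v].
Proof.
elim: s c => [|u s IH] c /=; first by rewrite in_nil; case: eqP => //= _; lia.
rewrite inE IH !xpair_eqE; case: (l' =P l) => //= _.
case: (ltngtP k c) => [lt|lt|->]; rewrite /= ?orbF ?addnS.
- by lia.
- by rewrite (_ : k - c = (k - c.+1).+1) /=; [congr andb|]; lia.
- by rewrite subnn ltnS leq_addr eq_sym.
Qed.

Lemma mem_entries l' k v l ls : ((l', k, v) \in entries l ls) =
  [&& l <= l' < l + size ls, 0 < k <= size (nth [::] ls (l' - l)) &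
      nth 0 (nth [::] ls (l' - l)) k.-1 == v].
Proof.
elim: ls l => [|s ls IH] l /=; first by rewrite addn0 leqNgt andNb.
rewrite mem_cat mem_numbered IH; case: (ltngtP l' l) => [lt|lt|->] /=.
- by [].
- by rewrite (_ : l' - l = (l' - l.+1).+1) /=; [rewrite addnS|lia].
- by rewrite subnn orbF add1n subn1 addnS ltnS leq_addr.
Qed.
End Parsing.

(** * Correctness of the algorithm *)

Definition wppsg_cmd : cmd symbol :=
  CSeq parse_stage
 (CSeq (order_stage symbol)
 (CSeq (sort_stage symbol) (verdict_stage symbol))).

Lemma size_encode_list s : 2 * size s < size (encode_list s).
Proof.
rewrite /encode_list size_rcons ltnS; elim: s => // v s IH.
have : 1 < size (encode_nat v) by rewrite size_rcons size_map /binary size_mkseq.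
by rewrite -[flatten _]/(encode_nat v ++ flatten (map encode_nat s)) size_cat [size (v :: s)]/=; lia.
Qed.

Lemma size_encode_lists ls :
  size ls + 2 * sumn (map size ls) <= size (flatten (map encode_list ls)).
Proof.
elim: ls => // s ls IH.
rewrite -[flatten _]/(encode_list s ++ flatten (map encode_list ls)) size_cat.
rewrite [sumn _]/= [size (s :: ls)]/=.
by move: (size_encode_list s) IH; lia.
Qed.

Lemma size_map_ord (T : Type) k (f : 'I_k -> T) : size [seq f i | i <- enum 'I_k] = k.
Proof. by rewrite size_map size_enum_ord. Qed.

Lemma nth_map_ord (T : Type) (d : T) k (f : 'I_k -> T) (j : 'I_k) :
  nth d [seq f i | i <- enum 'I_k] j = f j.
Proof. by rewrite (nth_map j) ?size_enum_ord // nth_ord_enum. Qed.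

(** * The parsed form of an instance *)

Section Instance.
Variable x : wppsg_instance.
Let n := wp_n x.
Let m := wp_m x.
Let w := wppsg_encode x.
Let N := size w.
Let rho := wp_target x.

Definition instance_lists : seq (seq nat) :=
  [:: wp_n x; wp_m x] :: [seq (wp_target x i).+1 | i <- enum 'I_(wp_n x)] ::
  [seq [seq i.+1 | i : 'I_(wp_n x) <- enum (wp_set j)] | j <- enum 'I_(wp_m x)].
Let ls := instance_lists.

Lemma wppsg_encodeE : w = flatten (map encode_list ls).
Proof. by rewrite /w /wppsg_encode /ls /instance_lists !map_cons -[map encode_list _]map_comp. Qed.

(** Every number costs at least a digit and a comma, every list a semicolon. The bound makes all
    stored numbers immune to saturation and usable as column indices. *)
Lemma instance_size : n + m + 4 < N.
Proof.
have := size_encode_lists ls; rewrite -wppsg_encodeE -/N /= !size_map_ord.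
by rewrite -/n -/m; lia.
Qed.

Lemma instance_lists_bound s : s \in ls -> all (ltn^~ N) s && (size s < N).
Proof.
have sz := instance_size.
rewrite !inE => /or3P[/eqP->|/eqP->|/mapP[j _ ->]].
- by rewrite /= -/n -/m; lia.
- rewrite size_map_ord -/n; apply/andP; split; last lia.
  by apply/allP => _ /mapP[i _ ->]; have := ltn_ord (wp_target x i); rewrite -/n /=; lia.
- rewrite size_map -cardE; apply/andP; split.
    by apply/allP => _ /mapP[i _ ->]; have := ltn_ord i; rewrite -/n /=; lia.
  by apply: leq_ltn_trans (max_card _) _; rewrite card_ord -/n; lia.
Qed.

Let A1 := arrs (exec N parse_stage (init_mem w)).

Lemma mem_entries_bound l k v : (l, k, v) \in entries 0 ls -> k < N /\ v < N.
Proof.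
rewrite mem_entries subn0 => /and3P[/andP[_ ll] /andP[k0 kle] /eqP E].
have sin : nth [::] ls l \in ls by apply: mem_nth.
have /andP[/allP sv sz] := instance_lists_bound sin; split; first exact: leq_ltn_trans kle sz.
by rewrite -E; apply: sv; apply: mem_nth; rewrite prednK.
Qed.

Lemma parsed_arrays :
  [/\ forall i, A1 2 i = marks (map (ix2 N) (entries 0 ls)) i,
      forall i, A1 3 i = marks (map (ix3 N) (entries 0 ls)) i &
      forall a i, a \notin [:: 0; 2; 3] -> A1 a i = cell0 _].
Proof.
have sz := instance_size.
have N0 : 0 < N by lia.
have := @parse_stage_spec N w erefl N0.
have -> : foldl (pstep N) pstart w = PState (size ls) 1 0 1 (rev (entries 0 ls)).
  rewrite /pstart {1}wppsg_encodeE foldl_lists //.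
    apply/allP => s /instance_lists_bound/andP[/allP sv ->]; rewrite andbT.
    by apply/allP => v /sv /ltnW.
  by rewrite /= size_map_ord -/m; lia.
case=> _ _ H2 H3 Ho; rewrite -/A1 in H2 H3 Ho.
by split=> // i; rewrite ?H2 ?H3 /= /marks map_rev mem_rev.
Qed.

Lemma parsed_set l v : v < N ->
  bit N A1 2 l v = (l < size ls) && (v \in nth [::] ls l).
Proof.
move=> lv; have [H2 _ _] := parsed_arrays.
rewrite /bit H2 /marks; have -> : ((if l * N + v \in map (ix2 N) (entries 0 ls)
    then cell1 symbol else cell0 symbol) == cell1 symbol) = (l * N + v \in map (ix2 N) (entries 0 ls)).
  by case: ifP.
apply/mapP/andP => [[[[l' k] v'] lkv E]|[ll vin]].
  have [_ lv'] := mem_entries_bound lkv.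
  move/eqP: E; rewrite /ix2 eq_ix // => /andP[/eqP-> /eqP->].
  move: lkv; rewrite mem_entries subn0 => /and3P[/andP[_ ->] /andP[k0 kle] /eqP<-].
  by split=> //; apply: mem_nth; rewrite prednK.
exists (l, (index v (nth [::] ls l)).+1, v) => //.
by rewrite mem_entries subn0 add0n ll /= index_mem vin nth_index ?eqxx.
Qed.

(** The target is list 1, whence the rows [N + y]; applying [eq_ix] twice recovers list, position
    and value from an address. *)
Lemma parsed_target y z : y < N -> z < N ->
  bit N A1 3 (N + y) z = [&& 0 < y <= n & nth 0 (nth [::] ls 1) y.-1 == z].
Proof.
move=> ly lz; have [_ H3 _] := parsed_arrays.
rewrite /bit H3 /marks; have -> : ((if (N + y) * N + z \in map (ix3 N) (entries 0 ls)
    then cell1 symbol else cell0 symbol) == cell1 symbol) = ((N + y) * N + z \in map (ix3 N) (entries 0 ls)).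
  by case: ifP.
have -> : [&& 0 < y <= n & nth 0 (nth [::] ls 1) y.-1 == z] = ((1, y, z) \in entries 0 ls).
  by rewrite mem_entries subn0 [size (nth _ _ _)]/= [size ls]/= !size_map_ord.
apply/mapP/idP => [[[[l' k] v'] lkv E]|yz]; last first.
  by exists (1, y, z) => //; rewrite /ix3 /= mul1n.
have [lk lv'] := mem_entries_bound lkv.
move/eqP: E; rewrite /ix3 eq_ix // => /andP[/= + /eqP->].
by rewrite -{1}(mul1n N) eq_ix // => /andP[/eqP El /eqP Ek]; rewrite -El -Ek in lkv.
Qed.

Lemma parsed_represents : represents N A1 rho.
Proof.
have sz := instance_size.
split=> [i z lz|y z ly lz out].
  rewrite parsed_target ?(ltn_ord i) //; last by have := ltn_ord i; rewrite -/n; lia.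
  by rewrite /= (nth_map i) ?size_enum_ord // nth_ord_enum eq_sym.
by rewrite parsed_target //; case: andP => // -[/andP[y0 yn] _]; lia.
Qed.

Let Xs := [seq wp_set j | j <- enum 'I_(wp_m x)].

Lemma parsed_set_in j (i : 'I_n) : bit N A1 2 (j + 2) i.+1 = (i \in nth set0 Xs j).
Proof.
have sz := instance_size.
rewrite parsed_set; last by have := ltn_ord i; lia.
rewrite addn2 /= size_map_ord !ltnS.
case: (ltnP j m) => lj /=; last by rewrite nth_default ?inE // size_map_ord.
pose j0 : 'I_(wp_m x) := Ordinal lj.
rewrite -[j]/(val j0) !nth_map_ord.
rewrite (mem_map (f := fun i : 'I_(wp_n x) => i.+1)) ?mem_enum // => a b [] /val_inj //.
Qed.

Lemma parsed_set_out j y : y < N -> (y == 0) || (n < y) -> bit N A1 2 (j + 2) y = false.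
Proof.
move=> ly out; rewrite parsed_set // addn2 /=; apply/negbTE/negP => /andP[lj].
rewrite !ltnS size_map_ord in lj; pose j0 : 'I_(wp_m x) := Ordinal lj.
rewrite -[j]/(val j0) nth_map_ord.
by case/mapP=> i _ E; move: out; rewrite E /= ltnNge ltn_ord.
Qed.

(** The key of an element is its position, that is, its image under the inverse of [pi]; an element
    between two members of a set in this order is itself a member. *)
Lemma order_exists : consecutive_ones x ->
  exists k : 'I_N -> nat, injective k /\
    forcing_closed (setr (N := N) A1) (fun y z => k y < k z).
Proof.
move=> [pi H]; have sz := instance_size.
(* Elements outside [1, ..., n] belong to no set and are put at the end. *)
pose k (y : 'I_N) : nat :=
  if insub y.-1 is Some i then if y == 0 :> nat then n else val (pi^-1%g (i : 'I_n))
  else n + y.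
(* Index 0 has its own test in [k] because [0.-1] is 0 and would be taken for the element stored as
   1. *)
have k_out (y : 'I_N) : (val y == 0) || (n < y) -> k y = n + y.
  rewrite /k; case: insubP => [i _ iE|//] /=.
  case: eqP => [->|/eqP y0] /=; first by rewrite addn0.
  by have := ltn_ord i; rewrite iE; lia.
have k_in (y : 'I_N) (i : 'I_n) : val y = i.+1 -> k y = (pi^-1%g i).
  move=> yE; rewrite /k yE /=; case: insubP => [i' _ iE|]; last by rewrite ltn_ord.
  by congr (val (pi^-1%g _)); apply: val_inj.
exists k; split=> [y z|j y z t].
  have := elt_cases n y; have := elt_cases n z.
  move=> [oz|[i zE]] [oy|[l yE]].
  - by rewrite !k_out // => /addnI /val_inj.
  - by rewrite (k_out z) // (k_in _ _ yE) => E; have := ltn_ord (pi^-1%g l); rewrite E; lia.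
  - by rewrite (k_out y) // (k_in _ _ zE) => E; have := ltn_ord (pi^-1%g i); rewrite -E; lia.
  - rewrite (k_in _ _ zE) (k_in _ _ yE) => /val_inj/perm_inj E.
    by apply: val_inj; rewrite /= yE zE E.
rewrite /setr.
have [oy|[a yE]] := elt_cases n y; first by rewrite parsed_set_out.
have [ot|[c tE]] := elt_cases n t; first by rewrite (parsed_set_out _ _ ot).
rewrite yE tE !parsed_set_in (k_in _ _ yE) (k_in _ _ tE).
have [oz|[b zE]] := elt_cases n z.
  rewrite (k_out _ oz) => _ _ _; have := ltn_ord (pi^-1%g a); have := ltn_ord (pi^-1%g c).
  by split; lia.
rewrite zE parsed_set_in (k_in _ _ zE).
case: (ltnP j m) => lj; last by rewrite nth_default ?inE // size_map_ord.
pose j0 : 'I_(wp_m x) := Ordinal lj.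
rewrite -[val j]/(val j0) nth_map_ord => aX cX bX.
have pa := permKV pi a; have pb := permKV pi b; have pc := permKV pi c.
have between p q : p \in wp_set j0 -> q \in wp_set j0 ->
    pi^-1%g p <= pi^-1%g b -> pi^-1%g b <= pi^-1%g q -> False.
  move=> pX qX l1 l2; move/negP: bX; apply.
  by rewrite -pb; apply: (H j0 (pi^-1%g p) _ (pi^-1%g q)); rewrite ?permKV ?l1.
split=> lt; rewrite ltnNge; apply/negP => le.
  by apply: (between a c) => //; apply: ltnW.
by apply: (between c a) => //; apply: ltnW.
Qed.

Lemma wppsg_cmd_correct : consecutive_ones x ->
  arrs (exec N wppsg_cmd (init_mem w)) 4 0 != cell1 symbol <-> wppsg_yes x.
Proof.
move=> c1; have sz := instance_size; have nN : n < N by lia.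
rewrite /wppsg_cmd 3!exec_seq; set m1 := exec N parse_stage (init_mem w).
have [_ _ Ho] := parsed_arrays.
have [k [k_inj k_cl]] := order_exists c1.
have [[sb irr tr cl] tot] := @order_stage_spec symbol N m1 k k_inj k_cl (fun i => Ho 1 i isT).
set m2 := exec N (order_stage symbol) m1 in sb irr tr cl tot *.
(* The order laws are transported from ['I_N] to the elements along this shift by one. *)
pose e (i : 'I_n) : 'I_N := Ordinal (eltN nN i).
have e_inj : injective e by move=> a b /(congr1 val) [] /val_inj.
have ltE i l : lt_elt N (arrs m2) i l = ordr (N := N) (arrs m2) (e i) (e l) by [].
have set_in j (i : 'I_n) : bit N (arrs m2) 2 (j + 2) i.+1 = (i \in nth set0 Xs j).
  by rewrite -parsed_set_in /bit sb.
have set_out j y : y < N -> (y == 0) || (n < y) -> bit N (arrs m2) 2 (j + 2) y = false.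
  by move=> ly out; rewrite /bit sb //; apply: parsed_set_out.
have rep2 : represents N (arrs m2) rho.
  by have [H1 H2] := parsed_represents; split=> *; rewrite /bit sb // -/(bit N A1 _ _ _) ?H1 ?H2.
have int B : B \in Xs -> interval (lt_elt N (arrs m2)) B.
  move=> /mapP[j _ ->] a b c ab bc aX cX; apply/negPn/negP => bX.
  have jN : j < N by have := ltn_ord j; rewrite -/m; lia.
  have inX i : setr (N := N) A1 (Ordinal jN) (e i) = (i \in wp_set j).
    by rewrite /setr parsed_set_in nth_map_ord.
  (* Forcing across the set turns a < b into c < b, against b < c. *)
  have [|||f _] := cl (Ordinal jN) (e a) (e b) (e c); rewrite ?inX //.
  by move: (tr (e c) (e b) (e b) bc (f ab)); rewrite irr.
have szX : size Xs <= N by rewrite size_map_ord -/m; lia.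
have [rho' [sb' rep' rhoE]] := @sort_stage_spec symbol N n nN (arrs m2) Xs set_in set_out
  (fun i => irr (e i)) (fun b a c => tr (e b) (e a) (e c))
  (fun a b ne => tot (e a) (e b) (contra_neq (@e_inj a b) ne)) int m2 rho erefl szX rep2.
set m3 := exec N (sort_stage symbol) m2 in sb' rep' *.
have R0 : arrs m3 4 0 = cell0 symbol by rewrite sb' // sb //; apply: Ho.
apply: (iff_trans (verdict_stage_spec nN rep' R0)); apply: (iff_trans rhoE).
apply: (iff_trans (iff_sym (sym_productP _ _ (enum_uniq 'I_(wp_m x))))).
have -> : enum 'I_(wp_m x) = index_enum 'I_(wp_m x) by rewrite [index_enum _]unlock enumT.
by [].
Qed.

End Instance.

Theorem theorem4p3 : polytime_solvable WPPSG1.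
Proof.
apply: (@cmd_polytime WPPSG1 wppsg_cmd 4) => -[x c1].
exact: (wppsg_cmd_correct c1).
Qed.
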